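(* For every $c_1>0$ the metric $$g=\frac{e^{2q}}{\sqrt{e^{2q}+c_1^2}}\,(dq^2+\sigma_3^2)+\sqrt{e^{2q}+c_1^2}\,(\sigma_1^2+\sigma_2^2),\qquad q\in\mathbb{R},$$ defined on $M=\mathcal{G}\times_{SO(2)}\mathbb{R}^2$, with $\mathcal{G}\simeq \mathrm{nil}_3/\tilde{\mathbb{Z}}$, is complete and centrally flat.
   Context: A Kähler metric $g$ on a $4$-manifold, with Kähler form $\omega$ and Ricci form $\rho$, is called centrally flat if $\rho\wedge\rho=0$ (equivalently, the determinant of its Ricci endomorphism vanishes identically). $\mathrm{nil}_3$ is the Heisenberg group of real upper triangular $3\times 3$ matrices with $1$'s on the diagonal, with coordinates $x$ (entry $(1,2)$), $y$ (entry $(2,3)$), $z$ (entry $(1,3)$). $\tilde{\mathbb{Z}}$ is the discrete central subgroup of matrices with $x=y=0$ and $z=2\pi n$, $n\in\mathbb{Z}$, and $\mathcal{G}=\mathrm{nil}_3/\tilde{\mathbb{Z}}$. The center $K$ of $\mathcal{G}$ (the image of $\{x=y=0\}$) is isomorphic to $SO(2)$ and acts linearly on $\mathbb{R}^2$ by rotations (the standard action). $M=\mathcal{G}\times_{K}\mathbb{R}^2$ is the homogeneous vector bundle in which points of $\mathcal G\times\mathbb R^2$ are identified via $(h,v)\sim(hk^{-1},kv)$, $k\in K$; $\mathcal{G}$ acts on $M$ by left multiplication on the first factor. The regular orbits are copies of $\mathcal{G}$ and the singular orbit (the zero section) is $\mathcal{G}/K\approx\mathbb{R}^2$. The left-invariant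 frame on $\mathcal{G}$ is $X_1=\partial_x$, $X_2=\partial_y+x\partial_z$, $X_3=-\partial_z$, with dual coframe $\sigma_1=dx$, $\sigma_2=dy$, $\sigma_3=x\,dy-dz$. The complement of the singular orbit in $M$ is identified with $\mathbb{R}\times\mathcal{G}$, where $q\in\mathbb{R}$ is the coordinate on the first factor and the singular orbit corresponds to $q=-\infty$. The displayed formula gives $g$ on this complement, and $g$ on $M$ means its smooth extension across the singular orbit (the distance to the singular orbit being the radial parameter of the $\mathbb{R}^2$ fibre). With $\phi(q)=\sqrt{e^{2q}+c_1^2}$, the Kähler form is (the smooth extension of) $\omega=d(\phi\,\sigma_3)=\phi'\,dq\wedge\sigma_3+\phi\,\sigma_1\wedge\sigma_2$. *)

(* Defs.v *)
(* Stdlib reals with Coquelicot. *)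
From Stdlib Require Import Reals Lra Lia ZArith FunctionalExtensionality.
From Coquelicot Require Import Coquelicot.
Open Scope R_scope.

(** * Tensor calculus in a global chart with values in R^4 *)

Inductive ix : Set := i0 | i1 | i2 | i3.

Definition ix_eq_dec (i j : ix) : {i = j} + {i <> j}.
Proof. decide equality. Defined.

Definition sum4 (f : ix -> R) : R := f i0 + f i1 + f i2 + f i3.

Definition delta (i j : ix) : R := if ix_eq_dec i j then 1 else 0.

(* Coquelicot's uniform structure on [ix -> R] is that of the sup distance, so
   [continuous] on [pt] refers to the usual topology of R^4. *)
Definition pt : Type := ix -> R.

Definition mkpt (a b c d : R) : pt :=
  fun i => match i with i0 => a | i1 => b | i2 => c | i3 => d end.

Definition upd (p : pt) (i : ix) (t : R) : pt :=
  fun j => if ix_eq_dec i j then t else p j.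

Definition partial (i : ix) (F : pt -> R) (p : pt) : R :=
  Derive (fun t => F (upd p i t)) (p i).

Fixpoint Ck (k : nat) (F : pt -> R) : Prop :=
  (forall p, continuous F p) /\
  match k with
  | O => True
  | S k' =>
      (forall i p, ex_derive (fun t => F (upd p i t)) (p i)) /\
      (forall i, Ck k' (partial i F))
  end.

Definition smooth (F : pt -> R) : Prop := forall k, Ck k F.

Definition form1 : Type := pt -> ix -> R.

(* Bilinear forms, [b p i j] being the value on the i-th and j-th coordinate
   vector fields. *)
Definition tensor2 : Type := pt -> ix -> ix -> R.

(* Endomorphisms of the tangent bundle: [J p k i] is the k-th component of the
   image of the i-th coordinate vector field. *)
Definition endo : Type := pt -> ix -> ix -> R.

(* Connections: [G p k i j] is the k-th component of the covariant derivative
   of the j-th coordinate vector field along the i-th one. *)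
Definition connection : Type := pt -> ix -> ix -> ix -> R.

Definition scale1 (f : pt -> R) (a : form1) : form1 := fun p i => f p * a p i.

Definition d1 (a : form1) : tensor2 :=
  fun p i j => partial i (fun x => a x j) p - partial j (fun x => a x i) p.

Definition d2 (w : tensor2) (p : pt) (i j k : ix) : R :=
  partial i (fun x => w x j k) p + partial j (fun x => w x k i) p
  + partial k (fun x => w x i j) p.

(* The coefficient on dx0 /\ dx1 /\ dx2 /\ dx3 of the wedge product of two
   2-forms. *)
Definition wedge22 (a b : tensor2) (p : pt) : R :=
  a p i0 i1 * b p i2 i3 - a p i0 i2 * b p i1 i3 + a p i0 i3 * b p i1 i2
  + a p i2 i3 * b p i0 i1 - a p i1 i3 * b p i0 i2 + a p i1 i2 * b p i0 i3.

Definition pullback (F : pt -> pt) (b : tensor2) : tensor2 :=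
  fun p i j =>
    sum4 (fun k => sum4 (fun l =>
      b (F p) k l * partial i (fun x => F x k) p * partial j (fun x => F x l) p)).

(** * Riemannian and Kähler geometry *)

Definition riemannian (g : tensor2) : Prop :=
  (forall i j, smooth (fun p => g p i j)) /\
  (forall p i j, g p i j = g p j i) /\
  (forall p (v : ix -> R), (exists i, v i <> 0) ->
     0 < sum4 (fun i => sum4 (fun j => g p i j * v i * v j))).

Definition levi_civita (g : tensor2) (G : connection) : Prop :=
  (forall p k i j, G p k i j = G p k j i) /\
  (forall p k i j,
     partial k (fun x => g x i j) p =
     sum4 (fun l => G p l k i * g p l j + G p l k j * g p i l)).

(* The l-th component of R(d_i, d_j) d_k. *)
Definition curvature (G : connection) (p : pt) (l i j k : ix) : R :=
  partial i (fun x => G x l j k) p - partial j (fun x => G x l i k) p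
  + sum4 (fun m => G p l i m * G p m j k - G p l j m * G p m i k).

Definition ricci (G : connection) : tensor2 :=
  fun p j k => sum4 (fun i => curvature G p i i j k).

(* b(J . , .); gives the Kähler form from g and the Ricci form from Ric. *)
Definition twist (b : tensor2) (J : endo) : tensor2 :=
  fun p i j => sum4 (fun k => J p k i * b p k j).

Definition kahler_form (g : tensor2) (J : endo) : tensor2 := twist g J.

Definition ricci_form (G : connection) (J : endo) : tensor2 :=
  twist (ricci G) J.

(* The k-th component of [J d_i, J d_j] - J [J d_i, d_j] - J [d_i, J d_j]
   + J^2 [d_i, d_j]. *)
Definition nijenhuis (J : endo) (p : pt) (k i j : ix) : R :=
  sum4 (fun l =>
    J p l i * partial l (fun x => J x k j) p
    - J p l j * partial l (fun x => J x k i) p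
    - J p k l * (partial i (fun x => J x l j) p - partial j (fun x => J x l i) p)).

Definition complex_structure (J : endo) : Prop :=
  (forall k i, smooth (fun p => J p k i)) /\
  (forall p k i, sum4 (fun l => J p k l * J p l i) = - delta k i) /\
  (forall p k i j, nijenhuis J p k i j = 0).

Definition kahler (g : tensor2) (J : endo) : Prop :=
  riemannian g /\
  complex_structure J /\
  (forall p i j,
     sum4 (fun k => sum4 (fun l => g p k l * J p k i * J p l j)) = g p i j) /\
  (forall p i j k, d2 (kahler_form g J) p i j k = 0).

(* The connection G is unique, g being nondegenerate. *)
Definition centrally_flat (g : tensor2) (J : endo) : Prop :=
  kahler g J /\
  exists G : connection,
    levi_civita g G /\
    forall p, wedge22 (ricci_form G J) (ricci_form G J) p = 0.

(** * Riemannian distance and completeness *)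

Definition velocity (c : R -> pt) (t : R) : ix -> R :=
  fun i => Derive (fun s => c s i) t.

Definition C1_curve (c : R -> pt) : Prop :=
  forall i t, ex_derive (fun s => c s i) t /\
              continuous (Derive (fun s => c s i)) t.

Definition length (g : tensor2) (c : R -> pt) : R :=
  RInt (fun t => sqrt (sum4 (fun i => sum4 (fun j =>
          g (c t) i j * velocity c t i * velocity c t j)))) 0 1.

(* [joined g p q L]: some piecewise C^1 curve from p to q has length L. Each
   C^1 piece is parametrized by [0, 1]; asking it to be the restriction of a
   C^1 curve defined on R is no restriction. *)
Inductive joined (g : tensor2) : pt -> pt -> R -> Prop :=
| joined_refl p : joined g p p 0
| joined_step c q L :
    C1_curve c -> joined g (c 1) q L -> joined g (c 0) q (length g c + L).

Definition dist (g : tensor2) (p q : pt) : R :=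
  real (Glb_Rbar (fun L => joined g p q L)).

Definition complete (g : tensor2) : Prop :=
  forall u : nat -> pt,
    (forall eps, 0 < eps ->
       exists N : nat, forall m n : nat, (N <= m)%nat -> (N <= n)%nat ->
         dist g (u m) (u n) < eps) ->
    exists p, is_lim_seq (fun n => dist g (u n) p) 0.

(** * The bundle M *)

(* An upper unitriangular 3x3 matrix, given by its entries (1,2), (2,3), (1,3). *)
Record nil3 : Type := Nil3 { nx : R; ny : R; nz : R }.

Definition nmul (h k : nil3) : nil3 :=
  Nil3 (nx h + nx k) (ny h + ny k) (nz h + nz k + nx h * ny k).

Definition ninv (h : nil3) : nil3 :=
  Nil3 (- nx h) (- ny h) (nx h * ny h - nz h).

Definition central (a : R) : nil3 := Nil3 0 0 a.

Definition lattice (n : Z) : nil3 := central (2 * PI * IZR n).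

Definition rot (a : R) (v : R * R) : R * R :=
  (cos a * fst v - sin a * snd v, sin a * fst v + cos a * snd v).

(* [M_rel (h, v) (h', v')]: the points of M represented by (h, v) and (h', v'),
   with h and h' read modulo the lattice, coincide; that is,
   (h', v') = (h k^-1, k v) for some k in the center, identified with SO(2)
   by sending [central a] to the rotation of angle a. *)
Definition M_rel (P P' : nil3 * (R * R)) : Prop :=
  exists (a : R) (n : Z),
    fst P' = nmul (nmul (fst P) (ninv (central a))) (lattice n) /\
    snd P' = rot a (snd P).

(* A global chart of M, induced by the section (x, y) |-> (x, y, 0) of
   nil3 -> nil3 / center. The lemmas [M_chart_rel] and [M_chart_surj] say that
   it is a bijection from M to R^4. The zero section is {p i2 = p i3 = 0}. *)
Definition M_chart (P : nil3 * (R * R)) : pt :=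
  let v := rot (nz (fst P)) (snd P) in
  mkpt (nx (fst P)) (ny (fst P)) (fst v) (snd v).

Lemma rot_add a b v : rot a (rot b v) = rot (a + b) v.
Proof.
  unfold rot; simpl; rewrite cos_plus, sin_plus; f_equal; ring.
Qed.

Lemma rot_0 v : rot 0 v = v.
Proof.
  destruct v as [u w]; unfold rot; simpl; rewrite cos_0, sin_0.
  f_equal; ring.
Qed.

Lemma rot_period a (n : Z) v : rot (a + 2 * PI * IZR n) v = rot a v.
Proof.
  unfold rot.
  assert (H : sin (a + 2 * PI * IZR n) = sin a /\
              cos (a + 2 * PI * IZR n) = cos a).
  { destruct (Z_le_dec 0 n) as [Hn | Hn].
    - rewrite <- (Z2Nat.id n Hn), <- INR_IZR_INZ.
      replace (a + 2 * PI * INR (Z.to_nat n))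
        with (a + 2 * INR (Z.to_nat n) * PI) by ring.
      split; [apply sin_period | apply cos_period].
    - set (m := Z.to_nat (- n)).
      assert (E : IZR n = - INR m).
      { unfold m; rewrite INR_IZR_INZ, Z2Nat.id by lia.
        rewrite opp_IZR; ring. }
      rewrite E.
      rewrite <- (sin_period (a + 2 * PI * - INR m) m).
      rewrite <- (cos_period (a + 2 * PI * - INR m) m).
      replace (a + 2 * PI * - INR m + 2 * INR m * PI) with a by ring.
      split; reflexivity. }
  destruct H as [-> ->]; reflexivity.
Qed.

Lemma M_chart_rel P P' : M_chart P = M_chart P' <-> M_rel P P'.
Proof.
  destruct P as [[x y z] v], P' as [[x' y' z'] v'].
  unfold M_chart, M_rel; cbn [fst snd nx ny nz]; split.
  - intros H.
    pose proof (f_equal (fun p : pt => p i0) H) as H0.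
    pose proof (f_equal (fun p : pt => p i1) H) as H1.
    pose proof (f_equal (fun p : pt => p i2) H) as H2.
    pose proof (f_equal (fun p : pt => p i3) H) as H3.
    cbn [mkpt] in H0, H1, H2, H3.
    assert (Hv : rot z v = rot z' v').
    { unfold rot; simpl in H2, H3; rewrite H2, H3; reflexivity. }
    exists (z - z'), 0%Z; split.
    + unfold nmul, ninv, lattice, central; simpl; f_equal; lra.
    + replace (z - z') with (- z' + z) by ring.
      rewrite <- rot_add, Hv, rot_add, Rplus_opp_l, rot_0; reflexivity.
  - intros (a & n & Hh & ->).
    unfold nmul, ninv, lattice, central in Hh; simpl in Hh.
    injection Hh as -> -> ->.
    rewrite rot_add.
    match goal with |- context [rot (?b + a) v] =>
      replace (b + a) with (z + 2 * PI * IZR n) by ring end.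
    rewrite rot_period.
    replace (x + -0 + 0) with x by ring.
    replace (y + -0 + 0) with y by ring.
    reflexivity.
Qed.

Lemma M_chart_surj p : exists P, M_chart P = p.
Proof.
  exists (Nil3 (p i0) (p i1) 0, (p i2, p i3)).
  apply functional_extensionality; intros i.
  unfold M_chart; cbn [fst snd nx ny nz]; rewrite rot_0.
  destruct i; reflexivity.
Qed.

(** * The metric and the Kähler form on R x G, in coordinates (q, x, y, z) *)

Definition phi (c1 q : R) : R := sqrt (exp (2 * q) + c1 ^ 2).

Definition dq : form1 := fun p => mkpt 1 0 0 0.
Definition sigma1 : form1 := fun p => mkpt 0 1 0 0.
Definition sigma2 : form1 := fun p => mkpt 0 0 1 0.
Definition sigma3 : form1 := fun p => mkpt 0 0 (p i1) (- 1).

Definition metric (c1 : R) : tensor2 := fun p i j =>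
  exp (2 * p i0) / sqrt (exp (2 * p i0) + c1 ^ 2)
    * (dq p i * dq p j + sigma3 p i * sigma3 p j)
  + sqrt (exp (2 * p i0) + c1 ^ 2)
    * (sigma1 p i * sigma1 p j + sigma2 p i * sigma2 p j).

Definition omega (c1 : R) : tensor2 :=
  d1 (scale1 (fun p => phi c1 (p i0)) sigma3).

(* The length from q = -oo of the q-curves, which are orthogonal to the orbits
   of G: the distance to the singular orbit. *)
Definition radius (c1 q : R) : R :=
  RInt_gen (fun s => sqrt (metric c1 (mkpt s 0 0 0) i0 i0))
           (Rbar_locally m_infty) (at_point q).

(* The identification of R x G with the complement of the zero section,
   (q, h) |-> [h, (radius q, 0)], read in the chart of M. It is periodic in z:
   the source is the universal cover of R x G. *)
Definition regular_part (c1 : R) (p : pt) : pt :=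
  M_chart (Nil3 (p i1) (p i2) (p i3), (radius c1 (p i0), 0)).

(* As the complement of the zero section is dense, a smooth tensor on M is
   determined by this property. *)
Definition extends_to_M (c1 : R) (b bM : tensor2) : Prop :=
  forall p i j, pullback (regular_part c1) bM p i j = b p i j.

(* Main.v *)
Require Import Defs.
From Stdlib Require Import Reals.
From Coquelicot Require Import Coquelicot.
From Stdlib Require Import Lra Lia FunctionalExtensionality Ranalysis5.
Open Scope R_scope.

(** The chart [(x, y, u, v)] of M is normalised by the distance to the zero
    section, which makes the metric transcendental: the profile function is the
    inverse [h] of the elliptic-type integral [arc]. The first idea is to write
    everything in terms of the functions [a = e^q cos z] and [b = e^q sin z] on
    M ([flat2] and [flat3]), which are [u] and [v] times [h r / r], where [r] is
    the radius of [(u, v)]. Since [h] is odd and smooth, [h r / r] is an even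
    smooth function of [r], hence a smooth function of [(u, v)], also at the
    origin ([smooth_radial]). With [phi = sqrt (a^2 + b^2 + c1^2)] the metric is
<<
      phi (dx^2 + dy^2) + ((da + b x dy)^2 + (db - a x dy)^2) / phi ,
>>
    which is smooth and positive definite on all of M, and the complex structure
    has constant coefficients in the coframe [dx, dy, da + b x dy, db - a x dy].
    The identity with the displayed metric on the regular part is a chain rule
    computation ([gM_extends], [kahler_form_extends]).

    The second idea is to compute with this moving coframe, whose connection
    forms have coefficients polynomial in [x, a, b] and [1 / phi^2], so that the
    curvature computation does not see [h]. The section on moving frames turns
    the structure equations into statements about the coordinate expressions: the
    connection obtained by gauge transformation is the Levi-Civita connection, the complex
    structure is parallel for it, and the Ricci tensor is a contraction of the
    curvature form. A parallel complex structure is integrable and has a closed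
    Kähler form ([parallel_kahler]). The curvature comes out as
    [Ric = - (dx^2 + dy^2)], so that the Ricci form is a constant multiple of
    [dx /\ dy] and its square vanishes ([gM_centrally_flat]). Conceptually,
    [x + i y] and [exp (- x^2 / 2) (a - i b)] are holomorphic coordinates in
    which the volume form has density [exp (x^2)].

    Completeness follows from a smooth function with bounded gradient on whose
    sublevel sets the metric dominates a multiple of the Euclidean one
    ([complete_of_exhaustion]); here [sqrt c1 * sqrt (1 + x^2) + sqrt phi]
    serves. It does not bound [y], but the metric is invariant under translation
    in [y]. *)

(* For equations stated in an algebraic structure with carrier R. *)
Ltac Rring := match goal with |- ?a = ?b => change (a = b :> R) end; ring.

(** * Calculus on R^4 *)

Lemma upd_same p i : upd p i (p i) = p.
Proof.
  apply functional_extensionality; intros j; unfold upd.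
  destruct (ix_eq_dec i j) as [<- | _]; reflexivity.
Qed.

Lemma upd_eq p i t : upd p i t i = t.
Proof. unfold upd; destruct (ix_eq_dec i i); congruence. Qed.

Lemma upd_upd p i s t : upd (upd p i s) i t = upd p i t.
Proof.
  apply functional_extensionality; intros k; unfold upd.
  destruct (ix_eq_dec i k); reflexivity.
Qed.

Lemma upd_comm p i j s t :
  i <> j -> upd (upd p i s) j t = upd (upd p j t) i s.
Proof.
  intros H; apply functional_extensionality; intros k; unfold upd.
  destruct (ix_eq_dec i k), (ix_eq_dec j k); congruence.
Qed.

Definition has_partial (i : ix) (F : pt -> R) (p : pt) : Prop :=
  ex_derive (fun t => F (upd p i t)) (p i).

Lemma has_partial_line i F p t :
  (forall q, has_partial i F q) ->
  is_derive (fun s => F (upd p i s)) t (partial i F (upd p i t)).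
Proof.
  intros H; specialize (H (upd p i t)).
  unfold has_partial in H; unfold partial; rewrite upd_eq in *.
  apply Derive_correct in H.
  eapply is_derive_ext; [| exact H].
  intros s; cbn; rewrite upd_upd; reflexivity.
Qed.

Lemma continuous_coord i p : continuous (fun q : pt => q i) p.
Proof.
  intros P [e He]; exists e; intros q Hq; apply He, (Hq i).
Qed.

Lemma Ck_continuous k F p : Ck k F -> continuous F p.
Proof. destruct k; intros [H _]; apply H. Qed.

Lemma Ck_down k F : Ck (S k) F -> Ck k F.
Proof.
  revert F; induction k as [| k IH]; intros F H.
  - split; [apply H | exact I].
  - destruct H as [Hc [Hd Hp]]; split; [exact Hc | split; [exact Hd |]].
    intros i; apply IH, Hp.
Qed.

Lemma Ck_const k a : Ck k (fun _ => a).
Proof.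
  revert a; induction k as [| k IH]; intros a.
  - split; [intros p; apply continuous_const | exact I].
  - split; [intros p; apply continuous_const | split].
    + intros i p; apply ex_derive_const.
    + intros i; replace (partial i (fun _ => a)) with (fun _ : pt => 0).
      * apply IH.
      * apply functional_extensionality; intros p; unfold partial.
        symmetry; apply Derive_const.
Qed.

Lemma partial_coord i j p : partial i (fun q => q j) p = delta i j.
Proof.
  unfold partial, delta, upd.
  destruct (ix_eq_dec i j).
  - apply Derive_id.
  - apply Derive_const.
Qed.

Lemma Ck_coord k j : Ck k (fun p => p j).
Proof.
  destruct k as [| k]; (split; [intros p; apply continuous_coord |]).
  - exact I.
  - split.
    + intros i p; unfold upd; destruct (ix_eq_dec i j).
      * apply ex_derive_id.
      * apply ex_derive_const.
    + intros i; replace (partial i (fun p => p j)) with (fun _ : pt => delta i j).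
      * apply Ck_const.
      * apply functional_extensionality; intros p; symmetry; apply partial_coord.
Qed.

Lemma partial_plus i F G p :
  has_partial i F p -> has_partial i G p ->
  partial i (fun q => F q + G q) p = partial i F p + partial i G p.
Proof. intros HF HG; exact (Derive_plus _ _ _ HF HG). Qed.

Lemma partial_mult i F G p :
  has_partial i F p -> has_partial i G p ->
  partial i (fun q => F q * G q) p = partial i F p * G p + F p * partial i G p.
Proof.
  intros HF HG; unfold partial.
  rewrite (Derive_mult _ _ _ HF HG), upd_same; reflexivity.
Qed.

Lemma has_partial_plus i F G p :
  has_partial i F p -> has_partial i G p ->
  has_partial i (fun q => F q + G q) p.
Proof. intros HF HG; exact (ex_derive_plus _ _ _ HF HG). Qed.

Lemma has_partial_mult i F G p :
  has_partial i F p -> has_partial i G p ->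
  has_partial i (fun q => F q * G q) p.
Proof. intros HF HG; exact (ex_derive_mult _ _ _ HF HG). Qed.

Lemma partial_comp i f F p l :
  has_partial i F p -> is_derive f (F p) l ->
  has_partial i (fun q => f (F q)) p /\
  partial i (fun q => f (F q)) p = l * partial i F p.
Proof.
  intros HF Hf.
  assert (H : is_derive (fun t => f (F (upd p i t))) (p i) (l * partial i F p)).
  { replace (l * partial i F p) with (scal (partial i F p) l)
      by (unfold scal; simpl; unfold mult; simpl; ring).
    apply (is_derive_comp f (fun t => F (upd p i t))).
    - rewrite upd_same; exact Hf.
    - apply Derive_correct, HF. }
  split; [eexists; exact H | apply is_derive_unique, H].
Qed.

Lemma Ck_plus k F G : Ck k F -> Ck k G -> Ck k (fun p => F p + G p).
Proof.
  revert F G; induction k as [| k IH]; intros F G HF HG.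
  - split; [| exact I].
    intros p; apply (continuous_plus F G); [apply HF | apply HG].
  - split.
    + intros p; apply (continuous_plus F G); [apply HF | apply HG].
    + destruct HF as [_ [HF HF']], HG as [_ [HG HG']]; split.
      * intros i p; apply has_partial_plus; [apply HF | apply HG].
      * intros i.
        replace (partial i (fun p => F p + G p))
          with (fun p => partial i F p + partial i G p).
        -- apply IH; auto.
        -- apply functional_extensionality; intros p; symmetry.
           apply partial_plus; [apply HF | apply HG].
Qed.

Lemma Ck_mult k F G : Ck k F -> Ck k G -> Ck k (fun p => F p * G p).
Proof.
  revert F G; induction k as [| k IH]; intros F G HF HG.
  - split; [| exact I].
    intros p; apply (continuous_mult F G); [apply HF | apply HG].
  - assert (HF0 := Ck_down _ _ HF); assert (HG0 := Ck_down _ _ HG); split.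
    + intros p; apply (continuous_mult F G); [apply HF | apply HG].
    + destruct HF as [_ [HF HF']], HG as [_ [HG HG']]; split.
      * intros i p; apply has_partial_mult; [apply HF | apply HG].
      * intros i.
        replace (partial i (fun p => F p * G p))
          with (fun p => partial i F p * G p + F p * partial i G p).
        -- apply Ck_plus; auto.
        -- apply functional_extensionality; intros p; symmetry.
           apply partial_mult; [apply HF | apply HG].
Qed.

Lemma Ck_inv k F : (forall p, F p <> 0) -> Ck k F -> Ck k (fun p => / F p).
Proof.
  intros Hn; revert F Hn; induction k as [| k IH]; intros F Hn HF.
  - split; [| exact I].
    intros p; apply (continuous_comp F Rinv).
    + apply HF.
    + apply continuity_pt_filterlim, continuity_pt_inv; [| apply Hn].
      apply continuity_pt_filterlim, continuous_id.
  - assert (HF0 := Ck_down _ _ HF); split.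
    + intros p; apply (continuous_comp F Rinv).
      * apply HF.
      * apply continuity_pt_filterlim, continuity_pt_inv; [| apply Hn].
        apply continuity_pt_filterlim, continuous_id.
    + destruct HF as [_ [HF HF']].
      assert (D : forall i p, has_partial i (fun q => / F q) p /\
        partial i (fun q => / F q) p
          = -1 * (/ F p * (/ F p)) * partial i F p).
      { intros i p; apply (partial_comp i Rinv); [apply HF |].
        evar_last; [apply (is_derive_inv (fun x => x)); [apply is_derive_id | apply Hn] |].
        unfold one; simpl; field; apply Hn. }
      split; [intros i p; apply D |].
      intros i.
      replace (partial i (fun p => / F p))
        with (fun p => -1 * (/ F p * (/ F p)) * partial i F p).
      * apply (Ck_mult k (fun p => -1 * (/ F p * / F p))); [| apply HF'].
        apply (Ck_mult k (fun _ => -1)); [apply Ck_const |].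
        apply Ck_mult; apply IH; auto.
      * apply functional_extensionality; intros p; symmetry; apply D.
Qed.

Lemma Ck_sqrt k F : (forall p, 0 < F p) -> Ck k F -> Ck k (fun p => sqrt (F p)).
Proof.
  intros Hn; revert F Hn; induction k as [| k IH]; intros F Hn HF.
  - split; [| exact I].
    intros p; apply (continuous_comp F sqrt); [apply HF | apply continuous_sqrt].
  - assert (HF0 := Ck_down _ _ HF); split.
    + intros p; apply (continuous_comp F sqrt); [apply HF | apply continuous_sqrt].
    + destruct HF as [_ [HF HF']].
      assert (D : forall i p, has_partial i (fun q => sqrt (F q)) p /\
        partial i (fun q => sqrt (F q)) p
          = / 2 * / sqrt (F p) * partial i F p).
      { intros i p; apply (partial_comp i sqrt); [apply HF |].
        assert (0 < sqrt (F p)) by (apply sqrt_lt_R0, Hn).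
        evar_last; [apply (is_derive_sqrt (fun x => x)); [apply is_derive_id | apply Hn] |].
        unfold one; simpl; field; lra. }
      split; [intros i p; apply D |].
      intros i.
      replace (partial i (fun p => sqrt (F p)))
        with (fun p => / 2 * / sqrt (F p) * partial i F p).
      * apply (Ck_mult k (fun p => / 2 * / sqrt (F p))); [| apply HF'].
        apply (Ck_mult k (fun _ => / 2)); [apply Ck_const |].
        apply Ck_inv; [| apply IH; auto].
        intros p; apply Rgt_not_eq, sqrt_lt_R0, Hn.
      * apply functional_extensionality; intros p; symmetry; apply D.
Qed.

Lemma smooth_const a : smooth (fun _ => a).
Proof. intros k; apply Ck_const. Qed.

Lemma smooth_coord j : smooth (fun p => p j).
Proof. intros k; apply Ck_coord. Qed.

Lemma smooth_plus F G : smooth F -> smooth G -> smooth (fun p => F p + G p).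
Proof. intros HF HG k; apply Ck_plus; auto. Qed.

Lemma smooth_mult F G : smooth F -> smooth G -> smooth (fun p => F p * G p).
Proof. intros HF HG k; apply Ck_mult; auto. Qed.

Lemma smooth_opp F : smooth F -> smooth (fun p => - F p).
Proof.
  intros HF; replace (fun p => - F p) with (fun p => -1 * F p).
  - apply (smooth_mult (fun _ => -1)); [apply smooth_const | exact HF].
  - apply functional_extensionality; intros p; ring.
Qed.

Lemma smooth_minus F G : smooth F -> smooth G -> smooth (fun p => F p - G p).
Proof. intros HF HG; apply (smooth_plus F (fun p => - G p)), smooth_opp; auto. Qed.

Lemma smooth_inv F : (forall p, F p <> 0) -> smooth F -> smooth (fun p => / F p).
Proof. intros Hn HF k; apply Ck_inv; auto. Qed.

Lemma smooth_sqrt F : (forall p, 0 < F p) -> smooth F -> smooth (fun p => sqrt (F p)).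
Proof. intros Hn HF k; apply Ck_sqrt; auto. Qed.

Lemma smooth_partial i F : smooth F -> smooth (partial i F).
Proof. intros HF k; apply (HF (S k)). Qed.

Lemma smooth_sum4 (F : ix -> pt -> R) :
  (forall i, smooth (F i)) -> smooth (fun p => sum4 (fun i => F i p)).
Proof. intros H; unfold sum4; repeat apply smooth_plus; apply H. Qed.

Lemma smooth_has_partial i F p : smooth F -> has_partial i F p.
Proof. intros HF; apply (HF 1%nat). Qed.

Lemma smooth_continuous F p : smooth F -> continuous F p.
Proof. intros HF; apply (Ck_continuous 0), HF. Qed.

Lemma partial_const i a p : partial i (fun _ => a) p = 0.
Proof. unfold partial; apply Derive_const. Qed.

Lemma partial_sum4 i (F : ix -> pt -> R) p :
  (forall j, smooth (F j)) ->
  partial i (fun q => sum4 (fun j => F j q)) p = sum4 (fun j => partial i (F j) p).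
Proof.
  intros H; unfold sum4.
  rewrite !partial_plus; auto using smooth_has_partial, has_partial_plus.
Qed.

Lemma partial_mult_s i F G p :
  smooth F -> smooth G ->
  partial i (fun q => F q * G q) p = partial i F p * G p + F p * partial i G p.
Proof. intros; apply partial_mult; apply smooth_has_partial; auto. Qed.

Lemma partial_plus_s i F G p :
  smooth F -> smooth G ->
  partial i (fun q => F q + G q) p = partial i F p + partial i G p.
Proof. intros; apply partial_plus; apply smooth_has_partial; auto. Qed.

Lemma smooth_sqr F : smooth F -> smooth (fun p => F p ^ 2).
Proof.
  intros H; replace (fun p => F p ^ 2) with (fun p => F p * F p).
  - apply smooth_mult; exact H.
  - apply functional_extensionality; intros p; ring.
Qed.

Lemma partial_sqr i F p :
  smooth F -> partial i (fun q => F q ^ 2) p = 2 * F p * partial i F p.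
Proof.
  intros H; replace (fun q => F q ^ 2) with (fun q => F q * F q)
    by (apply functional_extensionality; intros q; ring).
  rewrite partial_mult_s by assumption; ring.
Qed.

Lemma partial_scal i a F p :
  smooth F -> partial i (fun q => a * F q) p = a * partial i F p.
Proof.
  intros H; rewrite (partial_mult_s i (fun _ => a)), partial_const;
    [ring | apply smooth_const | exact H].
Qed.

Lemma partial_opp i F p : partial i (fun q => - F q) p = - partial i F p.
Proof. unfold partial; apply Derive_opp. Qed.

Lemma continuous_upd2 p i j u v :
  continuous (fun z : R * R => upd (upd p i (fst z)) j (snd z)) (u, v).
Proof.
  intros P [e He]; exists e; intros z [H1 H2]; apply He; intros k.
  unfold upd; destruct (ix_eq_dec j k); [exact H2 |].
  destruct (ix_eq_dec i k); [exact H1 | apply ball_center].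
Qed.

Lemma continuity_2d_upd2 F p i j u v :
  continuous F (upd (upd p i u) j v) ->
  continuity_2d_pt (fun s t => F (upd (upd p i s) j t)) u v.
Proof.
  intros H.
  apply continuity_2d_pt_filterlim.
  exact (continuous_comp (fun z : R * R => upd (upd p i (fst z)) j (snd z)) F (u, v)
           (continuous_upd2 p i j u v) H).
Qed.

(** Schwarz's theorem in the two-dimensional slice through [p] spanned by the
    directions [i] and [j]. *)
Lemma partial_comm i j F p :
  smooth F -> partial i (partial j F) p = partial j (partial i F) p.
Proof.
  intros HF; destruct (ix_eq_dec i j) as [<- | Hij]; [reflexivity |].
  assert (Hji : j <> i) by congruence.
  assert (Di : forall G, smooth G -> forall u v,
    is_derive (fun s => G (upd (upd p i s) j v)) u
              (partial i G (upd (upd p i u) j v))).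
  { intros G HG u v; rewrite (upd_comm p i j u v Hij).
    apply is_derive_ext with (fun s => G (upd (upd p j v) i s)).
    - intros s; rewrite (upd_comm p j i v s Hji); reflexivity.
    - apply has_partial_line; intros q; apply smooth_has_partial, HG. }
  assert (Dj : forall G, smooth G -> forall u v,
    is_derive (fun s => G (upd (upd p i u) j s)) v
              (partial j G (upd (upd p i u) j v))).
  { intros G HG u v; apply has_partial_line; intros q; apply smooth_has_partial, HG. }
  pose (f u v := F (upd (upd p i u) j v)).
  assert (Ej : forall u v, Derive (fun t => f u t) v = partial j F (upd (upd p i u) j v)).
  { intros; apply is_derive_unique, Dj, HF. }
  assert (Ei : forall u v, Derive (fun t => f t v) u = partial i F (upd (upd p i u) j v)).
  { intros; apply is_derive_unique, Di, HF. }
  assert (Eij : forall u v, Derive (fun z => Derive (fun t => f z t) v) u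
                = partial i (partial j F) (upd (upd p i u) j v)).
  { intros u v; erewrite Derive_ext by (intros; apply Ej).
    apply is_derive_unique, Di, smooth_partial, HF. }
  assert (Eji : forall u v, Derive (fun z => Derive (fun t => f t z) u) v
                = partial j (partial i F) (upd (upd p i u) j v)).
  { intros u v; erewrite Derive_ext by (intros; apply Ei).
    apply is_derive_unique, Dj, smooth_partial, HF. }
  assert (Hp : upd (upd p i (p i)) j (p j) = p) by (rewrite upd_same; apply upd_same).
  generalize (Schwarz f (p i) (p j)); rewrite Eij, Eji, Hp; intros HS; apply HS.
  - exists posreal_one; intros u v _ _; repeat split.
    + eexists; apply Di, HF.
    + eexists; apply Dj, HF.
    + eapply ex_derive_ext; [intros t; symmetry; apply Ej |].
      eexists; apply Di, smooth_partial, HF.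
    + eapply ex_derive_ext; [intros t; symmetry; apply Ei |].
      eexists; apply Dj, smooth_partial, HF.
  - apply continuity_2d_pt_ext with (fun u v => partial i (partial j F) (upd (upd p i u) j v)).
    + intros; symmetry; apply Eij.
    + apply continuity_2d_upd2, smooth_continuous, smooth_partial, smooth_partial, HF.
  - apply continuity_2d_pt_ext with (fun u v => partial j (partial i F) (upd (upd p i u) j v)).
    + intros; symmetry; apply Eji.
    + apply continuity_2d_upd2, smooth_continuous, smooth_partial, smooth_partial, HF.
Qed.

Lemma is_derive_eps (f : R -> R) (x l : R) :
  is_derive f x l <->
  forall e, 0 < e -> locally (x : R_UniformSpace) (fun y : R => Rabs (f y - f x - (y - x) * l) <= e * Rabs (y - x)).
Proof.
  split.
  - intros [_ H] e He.
    exact (H x (fun P HP => HP) (mkposreal e He)).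
  - intros H; split; [apply is_linear_scal_l |].
    intros y Hy e.
    rewrite <- (is_filter_lim_locally_unique (V := R_NormedModule) x y Hy).
    apply H, cond_pos.
Qed.

(** One step of the chain rule. By the mean value theorem the increment in the
    direction [k] is a value of the [k]-th partial derivative near [m t] times
    the increment of [c], and that partial derivative is continuous. *)
Lemma is_derive_coord_step F k (m : R -> pt) (c : R -> R) (t l : R) :
  Ck 1 F -> (forall s, m s k = c t) ->
  (forall i, continuous (fun s => m s i) t) -> is_derive c t l ->
  is_derive (fun s => F (upd (m s) k (c s)) - F (m s)) t (partial k F (m t) * l).
Proof.
  intros HF Hk Hm Hc.
  assert (HFc : continuous (partial k F) (m t)) by (apply (Ck_continuous 0), HF).
  assert (HFd : forall q, has_partial k F q) by (intros q; apply HF).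
  apply is_derive_eps; intros e He.
  set (A := partial k F (m t)).
  set (M := 1 + Rabs l + Rabs A).
  assert (HM : 1 <= M) by (unfold M; generalize (Rabs_pos l) (Rabs_pos A); lra).
  (* One tolerance [d] for the partial derivative, for the point and for the
     difference quotient of [c]; [M] bounds the sum of the three errors. *)
  set (d := Rmin 1 (e / M)).
  assert (Hd0 : 0 < d) by (apply Rmin_pos; [lra | apply Rdiv_lt_0_compat; lra]).
  assert (Hd1 : d <= 1) by apply Rmin_l.
  assert (HdM : d * M <= e).
  { apply Rle_trans with (e / M * M); [| right; field; lra].
    apply Rmult_le_compat_r; [lra | apply Rmin_r]. }
  destruct (HFc _ (locally_ball (A : R_UniformSpace) (mkposreal d Hd0))) as [r Hr].
  assert (Hcc : continuous c t) by (apply (ex_derive_continuous c); exists l; exact Hc).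
  assert (HL : forall i, locally t (fun s => ball (m t i : R_UniformSpace) r (m s i))).
  { intros i; exact (Hm i _ (locally_ball (m t i : R_UniformSpace) r)). }
  assert (HB : locally (t : R_UniformSpace) (fun s : R => ball (c t : R_UniformSpace) r (c s)))
    by exact (Hcc _ (locally_ball (c t : R_UniformSpace) r)).
  pose proof (proj1 (is_derive_eps c t l) Hc d Hd0) as HD.
  generalize (filter_and _ _ (HL i0) (filter_and _ _ (HL i1)
    (filter_and _ _ (HL i2) (filter_and _ _ (HL i3) (filter_and _ _ HB HD))))).
  apply filter_imp; intros s (B0 & B1 & B2 & B3 & Bc & Bd).
  assert (Hupd : upd (m t) k (c t) = m t) by (rewrite <- (Hk t); apply upd_same).
  assert (Hms : F (m s) = F (upd (m s) k (c t))) by (rewrite <- (Hk s), upd_same; reflexivity).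
  rewrite Hupd, Hms, Rminus_diag.
  destruct (MVT_gen (fun x => F (upd (m s) k x)) (c t) (c s)
              (fun x => partial k F (upd (m s) k x))) as (x & Hx & E).
  { intros; apply has_partial_line, HFd. }
  { intros; apply continuity_pt_filterlim.
    apply (ex_derive_continuous (fun x => F (upd (m s) k x))).
    eexists; apply has_partial_line, HFd. }
  cbv beta in E; rewrite E.
  assert (Hball : Rabs (partial k F (upd (m s) k x) - A) < d).
  { apply (Hr (upd (m s) k x)); intros i; unfold upd.
    destruct (ix_eq_dec k i) as [<- | _].
    - rewrite Hk. change (Rabs (x - c t) < r). change (Rabs (c s - c t) < r) in Bc.
      revert Hx Bc; unfold Rmin, Rmax, Rabs.
      destruct (Rle_dec (c t) (c s)), (Rcase_abs (c s - c t)), (Rcase_abs (x - c t)); lra.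
    - destruct i; assumption. }
  set (D := c s - c t) in *.
  set (q := partial k F (upd (m s) k x)) in *.
  replace (q * D - 0 - (s - t) * (A * l))
    with ((q - A) * D + A * (D - (s - t) * l)) by ring.
  assert (HD2 : Rabs D <= (Rabs l + d) * Rabs (s - t)).
  { replace D with ((D - (s - t) * l) + (s - t) * l) by ring.
    eapply Rle_trans; [apply Rabs_triang |].
    rewrite (Rabs_mult (s - t)); lra. }
  eapply Rle_trans; [apply Rabs_triang |].
  rewrite !Rabs_mult.
  assert (H1 : Rabs (q - A) * Rabs D <= d * ((Rabs l + d) * Rabs (s - t))).
  { apply Rmult_le_compat; try apply Rabs_pos; lra. }
  assert (H2 : Rabs A * Rabs (D - (s - t) * l) <= Rabs A * (d * Rabs (s - t))).
  { apply Rmult_le_compat_l; [apply Rabs_pos | exact Bd]. }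
  assert (H3 : d * (Rabs l + d + Rabs A) * Rabs (s - t) <= e * Rabs (s - t)).
  { apply Rmult_le_compat_r; [apply Rabs_pos |].
    eapply Rle_trans; [| exact HdM].
    apply Rmult_le_compat_l; unfold M; lra. }
  lra.
Qed.

(** The chain rule along a curve: the increment of [F] is split into four
    increments, each of which changes a single coordinate. *)
Lemma is_derive_curve F (c : R -> pt) t (v : ix -> R) :
  Ck 1 F -> (forall i, is_derive (fun s => c s i) t (v i)) ->
  is_derive (fun s => F (c s)) t (sum4 (fun i => partial i F (c t) * v i)).
Proof.
  intros HF Hc.
  assert (Hcc : forall i, continuous (fun s => c s i) t).
  { intros i; apply (ex_derive_continuous (fun s => c s i)); eexists; apply Hc. }
  pose (p := c t).
  pose (m0 := fun _ : R => p).
  pose (m1 := fun s => upd (m0 s) i0 (c s i0)).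
  pose (m2 := fun s => upd (m1 s) i1 (c s i1)).
  pose (m3 := fun s => upd (m2 s) i2 (c s i2)).
  assert (E1 : m1 t = p) by (apply upd_same).
  assert (E2 : m2 t = p) by (unfold m2; rewrite E1; apply upd_same).
  assert (E3 : m3 t = p) by (unfold m3; rewrite E2; apply upd_same).
  assert (E4 : forall s, upd (m3 s) i3 (c s i3) = c s).
  { intros s; apply functional_extensionality; intros i; destruct i; reflexivity. }
  assert (S : forall k m, (forall s, m s k = c t k) ->
    (forall i, continuous (fun s => m s i) t) -> m t = p ->
    is_derive (fun s => F (upd (m s) k (c s k)) - F (m s)) t (partial k F p * v k)).
  { intros k m H1 H2 H3; rewrite <- H3.
    apply (is_derive_coord_step F k m (fun s => c s k)); auto. }
  assert (S0 := S i0 m0 (fun _ => eq_refl) (fun i => continuous_const _ _) eq_refl).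
  assert (S1 : is_derive (fun s => F (upd (m1 s) i1 (c s i1)) - F (m1 s)) t
                 (partial i1 F p * v i1)).
  { apply S; [reflexivity | intros [] | exact E1];
      (apply Hcc || apply continuous_const). }
  assert (S2 : is_derive (fun s => F (upd (m2 s) i2 (c s i2)) - F (m2 s)) t
                 (partial i2 F p * v i2)).
  { apply S; [reflexivity | intros [] | exact E2];
      (apply Hcc || apply continuous_const). }
  assert (S3 : is_derive (fun s => F (upd (m3 s) i3 (c s i3)) - F (m3 s)) t
                 (partial i3 F p * v i3)).
  { apply S; [reflexivity | intros [] | exact E3];
      (apply Hcc || apply continuous_const). }
  apply is_derive_ext with (fun s => F p
    + ((F (upd (m0 s) i0 (c s i0)) - F (m0 s))
    + (F (upd (m1 s) i1 (c s i1)) - F (m1 s))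
    + (F (upd (m2 s) i2 (c s i2)) - F (m2 s))
    + (F (upd (m3 s) i3 (c s i3)) - F (m3 s)))).
  { intros s; rewrite E4.
    change (upd (m0 s) i0 (c s i0)) with (m1 s).
    change (upd (m1 s) i1 (c s i1)) with (m2 s).
    change (upd (m2 s) i2 (c s i2)) with (m3 s).
    unfold m0.
    Rring. }
  evar_last.
  - apply (is_derive_plus (fun _ => F p)); [apply is_derive_const |].
    apply (is_derive_plus (K := R_AbsRing) (V := R_NormedModule)); [| exact S3].
    apply (is_derive_plus (K := R_AbsRing) (V := R_NormedModule)); [| exact S2].
    apply (is_derive_plus (K := R_AbsRing) (V := R_NormedModule)); [exact S0 | exact S1].
  - unfold sum4, plus, zero; simpl; fold p.
    Rring.
Qed.


(** * Finite sums *)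

Lemma sum4_ext f g : (forall i, f i = g i) -> sum4 f = sum4 g.
Proof. intros H; unfold sum4; rewrite !H; reflexivity. Qed.

Lemma sum4_plus f g : sum4 (fun i => f i + g i) = sum4 f + sum4 g.
Proof. unfold sum4; ring. Qed.

Lemma sum4_minus f g : sum4 (fun i => f i - g i) = sum4 f - sum4 g.
Proof. unfold sum4; ring. Qed.

Lemma sum4_scal a f : sum4 (fun i => a * f i) = a * sum4 f.
Proof. unfold sum4; ring. Qed.

Lemma sum4_scal_r a f : sum4 (fun i => f i * a) = sum4 f * a.
Proof. unfold sum4; ring. Qed.

Lemma sum4_swap (f : ix -> ix -> R) :
  sum4 (fun i => sum4 (fun j => f i j)) = sum4 (fun j => sum4 (fun i => f i j)).
Proof. unfold sum4; ring. Qed.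

Lemma sum4_delta f j : sum4 (fun i => delta j i * f i) = f j.
Proof. unfold sum4, delta; destruct j; simpl; ring. Qed.

Lemma delta_sym i j : delta i j = delta j i.
Proof. unfold delta; destruct (ix_eq_dec i j), (ix_eq_dec j i); congruence. Qed.

(** * Parallel complex structures *)

Definition covariant_endo (G : connection) (J : endo) (p : pt) (l k i : ix) : R :=
  partial l (fun x => J x k i) p
  + sum4 (fun s => G p k l s * J p s i - J p k s * G p s l i).

Section Parallel.
Variables (g : tensor2) (G : connection) (J : endo).
Hypothesis Hg : riemannian g.
Hypothesis HG : levi_civita g G.
Hypothesis Jsmooth : forall k i, smooth (fun p => J p k i).
Hypothesis J2 : forall p k i, sum4 (fun l => J p k l * J p l i) = - delta k i.
Hypothesis Jg : forall p i j,
  sum4 (fun k => sum4 (fun l => g p k l * J p k i * J p l j)) = g p i j.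
Hypothesis Jpar : forall p l k i, covariant_endo G J p l k i = 0.

Lemma parallel_partial p l k i :
  partial l (fun x => J x k i) p
  = sum4 (fun s => J p k s * G p s l i) - sum4 (fun s => G p k l s * J p s i).
Proof.
  assert (H := Jpar p l k i); unfold covariant_endo in H.
  rewrite sum4_minus in H; lra.
Qed.

(** Replacing partial derivatives by the connection, every term of the Nijenhuis
    tensor is a product of two components of [J] and one of [G]; they cancel in
    pairs because [G] is symmetric. *)
Lemma parallel_nijenhuis p k i j : nijenhuis J p k i j = 0.
Proof.
  destruct HG as [Gs _].
  set (A := fun i j => sum4 (fun l => sum4 (fun s => J p l i * J p k s * G p s l j))).
  set (B := fun i j => sum4 (fun l => sum4 (fun s => J p l i * J p s j * G p k l s))).
  set (D := fun i j => sum4 (fun l => sum4 (fun s => J p k l * J p l s * G p s i j))).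
  assert (HB : B i j = B j i).
  { unfold B; rewrite sum4_swap; apply sum4_ext; intros l; apply sum4_ext; intros s.
    rewrite (Gs p k l s); ring. }
  assert (HD : D i j = D j i).
  { unfold D; apply sum4_ext; intros l; apply sum4_ext; intros s.
    rewrite (Gs p s i j); ring. }
  assert (HA : forall i j, A i j = sum4 (fun l => sum4 (fun s => J p k l * G p l j s * J p s i))).
  { intros a b; unfold A; rewrite sum4_swap; apply sum4_ext; intros l; apply sum4_ext; intros s.
    rewrite (Gs p l s b); ring. }
  transitivity ((A i j - B i j) - (A j i - B j i) - (D i j - A j i - (D j i - A i j))).
  2: rewrite HB, HD; ring.
  rewrite (HA i j) at 2; rewrite (HA j i) at 2.
  unfold A, B, D, nijenhuis; rewrite <- !sum4_minus.
  apply sum4_ext; intros l; rewrite !parallel_partial.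
  rewrite <- !sum4_minus, <- !sum4_scal, <- !sum4_minus.
  apply sum4_ext; intros s; ring.
Qed.

Lemma kahler_form_antisym p i j : kahler_form g J p i j = - kahler_form g J p j i.
Proof.
  destruct Hg as [_ [gs _]].
  unfold kahler_form, twist.
  transitivity (sum4 (fun k => sum4 (fun a => sum4 (fun b =>
    J p k i * (g p a b * J p a k * J p b j))))).
  { apply sum4_ext; intros k; rewrite <- (Jg p k j), <- sum4_scal.
    apply sum4_ext; intros a; rewrite <- sum4_scal; reflexivity. }
  transitivity (sum4 (fun b => sum4 (fun a => sum4 (fun k => J p a k * J p k i) * (g p a b * J p b j)))).
  { unfold sum4; ring. }
  transitivity (- 1 * sum4 (fun k => J p k j * g p k i)); [| ring].
  rewrite <- sum4_scal; apply sum4_ext; intros b.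
  transitivity (-1 * sum4 (fun a => delta i a * (g p a b * J p b j))).
  { rewrite <- sum4_scal; apply sum4_ext; intros a; rewrite J2, (delta_sym i a); ring. }
  rewrite sum4_delta, (gs p i b); ring.
Qed.

(** This says that the Kähler form is parallel, as [g] and [J] are. *)
Lemma parallel_form p m i j :
  partial m (fun x => kahler_form g J x i j) p
  = sum4 (fun s => G p s m i * kahler_form g J p s j + G p s m j * kahler_form g J p i s).
Proof.
  destruct Hg as [gsm [gs _]]; destruct HG as [_ Gm].
  unfold kahler_form, twist.
  rewrite (partial_sum4 m (fun k x => J x k i * g x k j)) by (intros; apply smooth_mult; auto).
  transitivity (sum4 (fun k =>
     (sum4 (fun s => J p k s * G p s m i) - sum4 (fun s => G p k m s * J p s i)) * g p k j
     + J p k i * sum4 (fun l => G p l m k * g p l j + G p l m j * g p k l))).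
  { apply sum4_ext; intros k.
    rewrite partial_mult_s, parallel_partial, Gm by auto; reflexivity. }
  unfold sum4; ring.
Qed.

(** For a symmetric connection the exterior derivative is the alternation of the
    covariant one, so a parallel form is closed; and the Nijenhuis tensor is
    likewise an expression in the covariant derivative of [J]. *)
Lemma parallel_kahler : kahler g J.
Proof.
  split; [exact Hg | split; [| split; [exact Jg |]]].
  - split; [exact Jsmooth | split; [exact J2 | apply parallel_nijenhuis]].
  - intros p i j k; unfold Defs.d2.
    rewrite (parallel_form p i j k), (parallel_form p j k i), (parallel_form p k i j), <- !sum4_plus.
    destruct HG as [Gs _].
    transitivity (sum4 (fun _ => 0)); [| unfold sum4; ring].
    apply sum4_ext; intros s.
    rewrite (kahler_form_antisym p k s), (kahler_form_antisym p i s),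
      (kahler_form_antisym p j s), (Gs p s j i), (Gs p s k i), (Gs p s k j); ring.
Qed.
End Parallel.

(** * Moving frames *)

Section Frame.
Variables (th ve : ix -> ix -> pt -> R) (H : ix -> pt -> R).
Hypothesis th_smooth : forall m j, smooth (th m j).
Hypothesis ve_smooth : forall j m, smooth (ve j m).
Hypothesis H_smooth : forall m, smooth (H m).
Hypothesis H_pos : forall m p, 0 < H m p.
Hypothesis th_ve : forall m n p, sum4 (fun j => th m j p * ve j n p) = delta m n.
Hypothesis ve_th : forall i j p, sum4 (fun m => ve i m p * th m j p) = delta i j.

Lemma th_ve_contract m p f :
  sum4 (fun l => th m l p * sum4 (fun n => ve l n p * f n)) = f m.
Proof.
  rewrite <- (sum4_delta f m).
  transitivity (sum4 (fun n => sum4 (fun l => th m l p * ve l n p) * f n)).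
  - unfold sum4; ring.
  - apply sum4_ext; intros n; rewrite th_ve; reflexivity.
Qed.

Lemma ve_th_contract l p f :
  sum4 (fun m => ve l m p * sum4 (fun j => th m j p * f j)) = f l.
Proof.
  rewrite <- (sum4_delta f l).
  transitivity (sum4 (fun n => sum4 (fun m => ve l m p * th m n p) * f n)).
  - unfold sum4; ring.
  - apply sum4_ext; intros n; rewrite ve_th; reflexivity.
Qed.

Lemma th_injective p f l :
  (forall m, sum4 (fun j => th m j p * f j) = 0) -> f l = 0.
Proof.
  intros Hf; rewrite <- (ve_th_contract l p f).
  transitivity (sum4 (fun m => ve l m p * 0)); [| unfold sum4; ring].
  apply sum4_ext; intros m; rewrite Hf; reflexivity.
Qed.

Definition frame_metric : tensor2 :=
  fun p i j => sum4 (fun m => H m p * th m i p * th m j p).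

Lemma frame_metric_square p v :
  sum4 (fun i => sum4 (fun j => frame_metric p i j * v i * v j))
  = sum4 (fun m => H m p * sum4 (fun i => th m i p * v i) ^ 2).
Proof. unfold frame_metric, sum4; ring. Qed.

Lemma frame_metric_smooth i j : smooth (fun p => frame_metric p i j).
Proof.
  apply smooth_sum4; intros m; apply smooth_mult; auto; apply smooth_mult; auto.
Qed.

Lemma frame_metric_riemannian : riemannian frame_metric.
Proof.
  split; [exact frame_metric_smooth | split].
  - intros p i j; unfold frame_metric; apply sum4_ext; intros m; ring.
  - intros p v [i Hi]; rewrite frame_metric_square.
    set (w := fun m => sum4 (fun i => th m i p * v i)).
    change (0 < sum4 (fun m => H m p * w m ^ 2)).
    assert (Hw : forall m, 0 <= H m p * w m ^ 2).
    { intros m; apply Rmult_le_pos; [left; apply H_pos | apply pow2_ge_0]. }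
    assert (Hz : forall m, H m p * w m ^ 2 = 0 -> w m = 0).
    { intros m Hm; apply Rmult_integral in Hm; destruct Hm as [Hm | Hm].
      - generalize (H_pos m p); lra.
      - apply Rsqr_0_uniq; unfold Rsqr; rewrite <- Hm; ring. }
    destruct (Rle_lt_or_eq_dec 0 (sum4 (fun m => H m p * w m ^ 2))) as [L | E]; [| exact L |].
    + unfold sum4; generalize (Hw i0) (Hw i1) (Hw i2) (Hw i3); lra.
    + exfalso; apply Hi, (th_injective p v i); intros m.
      apply (Hz m); unfold sum4 in E; generalize (Hw i0) (Hw i1) (Hw i2) (Hw i3).
      destruct m; lra.
Qed.

Variable Jc : ix -> ix -> R.
Hypothesis Jc2 : forall m n, sum4 (fun k => Jc m k * Jc k n) = - delta m n.
Hypothesis JcH : forall m n p, sum4 (fun k => H k p * Jc k m * Jc k n) = delta m n * H m p.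

Definition frame_endo : endo :=
  fun p k i => sum4 (fun m => ve k m p * sum4 (fun n => Jc m n * th n i p)).

Lemma th_endo m p i :
  sum4 (fun k => th m k p * frame_endo p k i) = sum4 (fun n => Jc m n * th n i p).
Proof. exact (th_ve_contract m p (fun m => sum4 (fun n => Jc m n * th n i p))). Qed.

Lemma frame_endo_smooth k i : smooth (fun p => frame_endo p k i).
Proof.
  apply smooth_sum4; intros m; apply smooth_mult; [apply ve_smooth |].
  apply smooth_sum4; intros n; apply smooth_mult; auto using smooth_const.
Qed.

Lemma frame_endo_square p k i :
  sum4 (fun l => frame_endo p k l * frame_endo p l i) = - delta k i.
Proof.
  transitivity (sum4 (fun m => ve k m p * sum4 (fun n => Jc m n
                  * sum4 (fun l => th n l p * frame_endo p l i)))).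
  { unfold frame_endo at 1; unfold sum4; ring. }
  transitivity (sum4 (fun m => ve k m p * sum4 (fun q => sum4 (fun n => Jc m n * Jc n q)
                  * th q i p))).
  { apply sum4_ext; intros m; f_equal.
    transitivity (sum4 (fun n => Jc m n * sum4 (fun q => Jc n q * th q i p))).
    - apply sum4_ext; intros n; rewrite th_endo; reflexivity.
    - unfold sum4; ring. }
  transitivity (-1 * sum4 (fun m => ve k m p * th m i p)); [| rewrite ve_th; ring].
  rewrite <- sum4_scal; apply sum4_ext; intros m.
  transitivity (ve k m p * (-1 * sum4 (fun q => delta m q * th q i p))).
  - f_equal; rewrite <- sum4_scal; apply sum4_ext; intros q; rewrite Jc2; ring.
  - rewrite sum4_delta; ring.
Qed.

Lemma frame_kahler_form p i j :
  kahler_form frame_metric frame_endo p i j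
  = sum4 (fun m => H m p * sum4 (fun n => Jc m n * th n i p) * th m j p).
Proof.
  unfold kahler_form, twist, frame_metric.
  transitivity (sum4 (fun m => H m p * sum4 (fun k => th m k p * frame_endo p k i) * th m j p)).
  - unfold sum4; ring.
  - apply sum4_ext; intros m; rewrite th_endo; reflexivity.
Qed.

Lemma frame_endo_isometry p i j :
  sum4 (fun k => sum4 (fun l => frame_metric p k l * frame_endo p k i * frame_endo p l j))
  = frame_metric p i j.
Proof.
  transitivity (sum4 (fun m => H m p * sum4 (fun k => th m k p * frame_endo p k i)
                               * sum4 (fun k => th m k p * frame_endo p k j))).
  { unfold frame_metric.
    unfold sum4; ring. }
  transitivity (sum4 (fun m => sum4 (fun n => sum4 (fun k => H k p * Jc k m * Jc k n)
                  * (th m i p * th n j p)))).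
  { transitivity (sum4 (fun m => H m p * sum4 (fun n => Jc m n * th n i p)
                                 * sum4 (fun n => Jc m n * th n j p))).
    - apply sum4_ext; intros m; rewrite !th_endo; reflexivity.
    - unfold sum4; ring. }
  unfold frame_metric; apply sum4_ext; intros m.
  transitivity (sum4 (fun n => delta m n * (H m p * th m i p * th n j p))).
  - apply sum4_ext; intros n; rewrite JcH; ring.
  - apply (sum4_delta (fun n => H m p * th m i p * th n j p)).
Qed.

(* [C m n a] is the coefficient of the [a]-th coframe element in the [(m, n)]
   entry of the matrix of connection forms, and [DC m n a b] its derivative
   along the [b]-th frame vector. *)
Variables (C : ix -> ix -> ix -> pt -> R) (DC : ix -> ix -> ix -> ix -> pt -> R).
Hypothesis C_smooth : forall m n a, smooth (C m n a).

Definition conn_form (i m n : ix) (p : pt) : R := sum4 (fun a => C m n a p * th a i p).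

Hypothesis partial_C : forall i m n a p,
  partial i (C m n a) p = sum4 (fun b => DC m n a b p * th b i p).
Hypothesis torsion : forall i j m p,
  partial i (th m j) p - partial j (th m i) p
  = sum4 (fun b => sum4 (fun c => (C m b c p - C m c b p) * th b i p * th c j p)).
Hypothesis metric_compat : forall l m n p,
  delta m n * partial l (H m) p = H m p * conn_form l m n p + H n p * conn_form l n m p.
Hypothesis Jc_commute : forall m n a p,
  sum4 (fun k => C m k a p * Jc k n) = sum4 (fun k => Jc m k * C k n a p).

(** The [m]-th frame component of the covariant derivative of the [j]-th
    coordinate field along the [i]-th one: the gauge transform of the connection
    matrix by the coframe. *)
Definition frame_cov (i m j : ix) (p : pt) : R :=
  sum4 (fun n => conn_form i m n p * th n j p) + partial i (th m j) p.

Definition frame_conn : connection :=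
  fun p k i j => sum4 (fun m => ve k m p * frame_cov i m j p).

Lemma conn_form_smooth i m n : smooth (conn_form i m n).
Proof.
  apply smooth_sum4; intros a; apply smooth_mult; auto.
Qed.

Lemma cov_smooth i m j : smooth (frame_cov i m j).
Proof.
  apply smooth_plus; [| exact (smooth_partial i _ (th_smooth m j))].
  apply smooth_sum4; intros n; apply smooth_mult; [apply conn_form_smooth | apply th_smooth].
Qed.

Lemma frame_conn_smooth k i j : smooth (fun p => frame_conn p k i j).
Proof.
  apply smooth_sum4; intros m; apply smooth_mult; [apply ve_smooth | apply cov_smooth].
Qed.

Lemma th_conn m p i j : sum4 (fun l => th m l p * frame_conn p l i j) = frame_cov i m j p.
Proof. exact (th_ve_contract m p (fun m => frame_cov i m j p)). Qed.

Lemma cov_sym i m j p : frame_cov i m j p = frame_cov j m i p.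
Proof.
  unfold frame_cov.
  replace (partial i (th m j) p) with (partial j (th m i) p
    + sum4 (fun b => sum4 (fun c => (C m b c p - C m c b p) * th b i p * th c j p)))
    by (rewrite <- torsion; ring).
  unfold conn_form, sum4; ring.
Qed.

Lemma frame_levi_civita : levi_civita frame_metric frame_conn.
Proof.
  split.
  - intros p k i j; unfold frame_conn; apply sum4_ext; intros m; rewrite cov_sym; reflexivity.
  - intros p k i j; symmetry.
    transitivity (sum4 (fun m => H m p * (th m j p * sum4 (fun l => th m l p * frame_conn p l k i)
                                     + th m i p * sum4 (fun l => th m l p * frame_conn p l k j)))).
    { unfold frame_metric.
      unfold sum4; ring. }
    transitivity (sum4 (fun m => H m p * (th m j p * frame_cov k m i p + th m i p * frame_cov k m j p))).
    { apply sum4_ext; intros m; rewrite !th_conn; reflexivity. }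
    transitivity (sum4 (fun m => sum4 (fun n =>
        (H m p * conn_form k m n p + H n p * conn_form k n m p) * (th m i p * th n j p)))
      + sum4 (fun m => H m p * (th m j p * partial k (th m i) p + th m i p * partial k (th m j) p))).
    { unfold frame_cov, sum4; ring. }
    transitivity (sum4 (fun m => partial k (H m) p * th m i p * th m j p
      + H m p * (th m j p * partial k (th m i) p + th m i p * partial k (th m j) p))).
    { rewrite sum4_plus; f_equal; apply sum4_ext; intros m.
      rewrite <- (sum4_delta (fun n => partial k (H m) p * th m i p * th n j p) m).
      apply sum4_ext; intros n; rewrite <- metric_compat; ring. }
    unfold frame_metric.
    rewrite (partial_sum4 k (fun m x => H m x * th m i x * th m j x)).
    + apply sum4_ext; intros m.
      rewrite (partial_mult_s k (fun x => H m x * th m i x)), (partial_mult_s k (H m)) by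
        auto using smooth_mult.
      ring.
    + intros m; apply smooth_mult; auto; apply smooth_mult; auto.
Qed.

(** Differentiating [th_endo] expresses the derivative of the endomorphism by that
    of the coframe; the latter cancels against the inhomogeneous part of the
    gauge transformation, and what is left is the commutator of the connection
    matrix with the constant matrix [Jc]. *)
Lemma frame_endo_parallel p l k i : covariant_endo frame_conn frame_endo p l k i = 0.
Proof.
  apply (th_injective p (fun k => covariant_endo frame_conn frame_endo p l k i)); intros m.
  assert (E : sum4 (fun k => partial l (th m k) p * frame_endo p k i
                             + th m k p * partial l (fun x => frame_endo x k i) p)
              = sum4 (fun n => Jc m n * partial l (th n i) p)).
  { transitivity (partial l (fun x => sum4 (fun k => th m k x * frame_endo x k i)) p).
    - rewrite (partial_sum4 l (fun k x => th m k x * frame_endo x k i)) by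
        (intros; apply smooth_mult; [apply th_smooth | apply frame_endo_smooth]).
      apply sum4_ext; intros k'; rewrite partial_mult_s; auto using frame_endo_smooth.
    - replace (fun x => sum4 (fun k => th m k x * frame_endo x k i))
        with (fun x => sum4 (fun n => Jc m n * th n i x))
        by (apply functional_extensionality; intros x; symmetry; apply th_endo).
      rewrite (partial_sum4 l (fun n x => Jc m n * th n i x)) by
        (intros; apply smooth_mult; auto using smooth_const).
      apply sum4_ext; intros n; apply partial_scal; auto. }
  unfold covariant_endo.
  transitivity (
    sum4 (fun k => partial l (th m k) p * frame_endo p k i
                   + th m k p * partial l (fun x => frame_endo x k i) p)
    - sum4 (fun k => partial l (th m k) p * frame_endo p k i)
    + sum4 (fun s => sum4 (fun k => th m k p * frame_conn p k l s) * frame_endo p s i)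
    - sum4 (fun s => sum4 (fun k => th m k p * frame_endo p k s) * frame_conn p s l i)).
  { unfold sum4; ring. }
  rewrite E.
  transitivity (sum4 (fun n => Jc m n * partial l (th n i) p)
    + sum4 (fun n => conn_form l m n p * sum4 (fun k => th n k p * frame_endo p k i))
    - sum4 (fun n => Jc m n * sum4 (fun s => th n s p * frame_conn p s l i))).
  { transitivity (sum4 (fun n => Jc m n * partial l (th n i) p)
      - sum4 (fun k => partial l (th m k) p * frame_endo p k i)
      + sum4 (fun s => frame_cov l m s p * frame_endo p s i)
      - sum4 (fun s => sum4 (fun n => Jc m n * th n s p) * frame_conn p s l i)).
    - f_equal; [f_equal |]; apply sum4_ext; intros s;
        [rewrite th_conn | rewrite th_endo]; reflexivity.
    - unfold frame_cov; unfold sum4; ring. }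
  transitivity (sum4 (fun n => sum4 (fun a =>
      (sum4 (fun k => C m k a p * Jc k n) - sum4 (fun k => Jc m k * C k n a p))
       * th a l p * th n i p))).
  { transitivity (sum4 (fun n => Jc m n * partial l (th n i) p)
      + sum4 (fun n => conn_form l m n p * sum4 (fun q => Jc n q * th q i p))
      - sum4 (fun n => Jc m n * frame_cov l n i p)).
    - f_equal; [f_equal |]; apply sum4_ext; intros s;
        [rewrite th_endo | rewrite th_conn]; reflexivity.
    - unfold frame_cov, conn_form, sum4; ring. }
  transitivity (sum4 (fun _ => sum4 (fun _ => 0))); [| unfold sum4; ring].
  apply sum4_ext; intros n; apply sum4_ext; intros a; rewrite Jc_commute; ring.
Qed.

Lemma frame_kahler : kahler frame_metric frame_endo.
Proof.
  apply (parallel_kahler frame_metric frame_conn frame_endo).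
  - exact frame_metric_riemannian.
  - exact frame_levi_civita.
  - exact frame_endo_smooth.
  - exact frame_endo_square.
  - exact frame_endo_isometry.
  - exact frame_endo_parallel.
Qed.

Definition curv_form (i j m n : ix) (p : pt) : R :=
  partial i (conn_form j m n) p - partial j (conn_form i m n) p
  + sum4 (fun q => conn_form i m q p * conn_form j q n p - conn_form j m q p * conn_form i q n p).

Lemma partial_th_conn i j k m p :
  sum4 (fun l => partial i (th m l) p * frame_conn p l j k)
  + sum4 (fun l => th m l p * partial i (fun x => frame_conn x l j k) p)
  = sum4 (fun n => partial i (conn_form j m n) p * th n k p
                   + conn_form j m n p * partial i (th n k) p)
    + partial i (partial j (th m k)) p.
Proof.
  transitivity (partial i (fun x => sum4 (fun l => th m l x * frame_conn x l j k)) p).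
  - rewrite (partial_sum4 i (fun l x => th m l x * frame_conn x l j k)) by
      (intros; apply smooth_mult; auto using frame_conn_smooth).
    rewrite <- sum4_plus; apply sum4_ext; intros l.
    rewrite partial_mult_s; auto using frame_conn_smooth.
  - replace (fun x => sum4 (fun l => th m l x * frame_conn x l j k)) with (frame_cov j m k)
      by (apply functional_extensionality; intros x; symmetry; apply th_conn).
    unfold frame_cov.
    rewrite partial_plus_s, (partial_sum4 i (fun n x => conn_form j m n x * th n k x)).
    + f_equal; apply sum4_ext; intros n; rewrite partial_mult_s;
        auto using conn_form_smooth.
    + intros; apply smooth_mult; auto using conn_form_smooth.
    + apply smooth_sum4; intros; apply smooth_mult; auto using conn_form_smooth.
    + apply smooth_partial, th_smooth.
Qed.

Lemma conn_conn i j k m p :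
  sum4 (fun l => th m l p * sum4 (fun s => frame_conn p l i s * frame_conn p s j k))
  = sum4 (fun n => conn_form i m n p * frame_cov j n k p)
    + sum4 (fun s => partial i (th m s) p * frame_conn p s j k).
Proof.
  transitivity (sum4 (fun s => sum4 (fun l => th m l p * frame_conn p l i s) * frame_conn p s j k)).
  { unfold sum4; ring. }
  transitivity (sum4 (fun s => frame_cov i m s p * frame_conn p s j k)).
  { apply sum4_ext; intros s; rewrite th_conn; reflexivity. }
  transitivity (sum4 (fun n => conn_form i m n p * sum4 (fun s => th n s p * frame_conn p s j k))
    + sum4 (fun s => partial i (th m s) p * frame_conn p s j k)).
  { unfold frame_cov; unfold sum4; ring. }
  f_equal; apply sum4_ext; intros n; rewrite th_conn; reflexivity.
Qed.

(** Curvature is covariant under gauge transformations. Differentiating [th_conn]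
    produces the second derivatives of the coframe, which disappear on
    alternation, and first derivatives that cancel against those in the product
    of connections ([conn_conn]). The inverse matrix [ve] is never
    differentiated. *)
Lemma th_curvature m p i j k :
  sum4 (fun l => th m l p * curvature frame_conn p l i j k)
  = sum4 (fun n => curv_form i j m n p * th n k p).
Proof.
  transitivity (
    sum4 (fun l => th m l p * partial i (fun x => frame_conn x l j k) p)
    - sum4 (fun l => th m l p * partial j (fun x => frame_conn x l i k) p)
    + sum4 (fun l => th m l p * sum4 (fun s => frame_conn p l i s * frame_conn p s j k))
    - sum4 (fun l => th m l p * sum4 (fun s => frame_conn p l j s * frame_conn p s i k))).
  { rewrite <- sum4_minus, <- sum4_plus, <- sum4_minus; apply sum4_ext; intros l.
    unfold curvature; rewrite sum4_minus; ring. }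
  rewrite !conn_conn.
  assert (E1 := partial_th_conn i j k m p).
  assert (E2 := partial_th_conn j i k m p).
  rewrite (partial_comm j i (th m k) p (th_smooth m k)) in E2.
  transitivity (
    sum4 (fun n => partial i (conn_form j m n) p * th n k p + conn_form j m n p * partial i (th n k) p)
    - sum4 (fun n => partial j (conn_form i m n) p * th n k p + conn_form i m n p * partial j (th n k) p)
    + sum4 (fun n => conn_form i m n p * frame_cov j n k p)
    - sum4 (fun n => conn_form j m n p * frame_cov i n k p)); [lra |].
  clear E1 E2.
  unfold curv_form, frame_cov.
  unfold sum4; ring.
Qed.

(** The coefficient of the [b]-th wedge [c]-th coframe elements in the curvature
    form; the differences [C a b c p - C a c b p] are the structure functions of
    the coframe, by [torsion]. *)
Definition curv_coef (m n b c : ix) (p : pt) : R :=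
  DC m n c b p - DC m n b c p
  + sum4 (fun a => C m n a p * (C a b c p - C a c b p)
                   + (C m a b p * C a n c p - C m a c p * C a n b p)).

Lemma curv_form_coef i j m n p :
  curv_form i j m n p
  = sum4 (fun b => sum4 (fun c => curv_coef m n b c p * (th b i p * th c j p))).
Proof.
  assert (E : forall i j, partial i (conn_form j m n) p
    = sum4 (fun a => sum4 (fun b => DC m n a b p * th b i p) * th a j p
                     + C m n a p * partial i (th a j) p)).
  { intros i' j'; unfold conn_form.
    rewrite (partial_sum4 i' (fun a x => C m n a x * th a j' x)) by (intros; apply smooth_mult; auto).
    apply sum4_ext; intros a; rewrite partial_mult_s, partial_C; auto. }
  unfold curv_form; rewrite !E.
  transitivity (
    sum4 (fun a => sum4 (fun b => DC m n a b p * th b i p) * th a j p)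
    - sum4 (fun a => sum4 (fun b => DC m n a b p * th b j p) * th a i p)
    + sum4 (fun a => C m n a p * (partial i (th a j) p - partial j (th a i) p))
    + sum4 (fun q => conn_form i m q p * conn_form j q n p - conn_form j m q p * conn_form i q n p)).
  { unfold sum4; ring. }
  transitivity (
    sum4 (fun a => sum4 (fun b => DC m n a b p * th b i p) * th a j p)
    - sum4 (fun a => sum4 (fun b => DC m n a b p * th b j p) * th a i p)
    + sum4 (fun a => C m n a p * 
        sum4 (fun b => sum4 (fun c => (C a b c p - C a c b p) * th b i p * th c j p)))
    + sum4 (fun q => conn_form i m q p * conn_form j q n p - conn_form j m q p * conn_form i q n p)).
  { f_equal; f_equal; apply sum4_ext; intros a; rewrite torsion; reflexivity. }
  unfold conn_form, curv_coef, sum4; ring.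
Qed.

(** Contracting the vector index with the first form index pairs [ve] with [th],
    which leaves a contraction of frame coefficients. *)
Lemma frame_ricci p j k :
  ricci frame_conn p j k
  = sum4 (fun c => sum4 (fun n => sum4 (fun m => curv_coef m n m c p) * (th c j p * th n k p))).
Proof.
  unfold ricci.
  transitivity (sum4 (fun i => sum4 (fun m => ve i m p
    * sum4 (fun n => curv_form i j m n p * th n k p)))).
  { apply sum4_ext; intros i.
    rewrite <- (ve_th_contract i p (fun l => curvature frame_conn p l i j k)).
    apply sum4_ext; intros m; rewrite th_curvature; reflexivity. }
  transitivity (sum4 (fun i => sum4 (fun m => sum4 (fun b => (th b i p * ve i m p)
    * sum4 (fun n => sum4 (fun c => curv_coef m n b c p * (th c j p * th n k p))))))).
  { apply sum4_ext; intros i; apply sum4_ext; intros m.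
    transitivity (ve i m p * sum4 (fun n => 
      sum4 (fun b => sum4 (fun c => curv_coef m n b c p * (th b i p * th c j p))) * th n k p)).
    { f_equal; apply sum4_ext; intros n; rewrite curv_form_coef; reflexivity. }
    unfold sum4; ring. }
  transitivity (sum4 (fun m => sum4 (fun b => delta b m
    * sum4 (fun n => sum4 (fun c => curv_coef m n b c p * (th c j p * th n k p)))))).
  { rewrite sum4_swap; apply sum4_ext; intros m.
    rewrite sum4_swap; apply sum4_ext; intros b.
    rewrite sum4_scal_r, th_ve; reflexivity. }
  transitivity (sum4 (fun m => sum4 (fun n => sum4 (fun c =>
      curv_coef m n m c p * (th c j p * th n k p))))).
  { apply sum4_ext; intros m.
    rewrite <- (sum4_delta (fun b => sum4 (fun n => sum4 (fun c =>
      curv_coef m n b c p * (th c j p * th n k p)))) m).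
    apply sum4_ext; intros b; rewrite delta_sym; reflexivity. }
  rewrite sum4_swap.
  transitivity (sum4 (fun n => sum4 (fun c => sum4 (fun m =>
      curv_coef m n m c p * (th c j p * th n k p))))).
  { apply sum4_ext; intros n; rewrite sum4_swap; reflexivity. }
  rewrite sum4_swap; apply sum4_ext; intros c; apply sum4_ext; intros n.
  apply sum4_scal_r.
Qed.

Lemma frame_ricci_form p i j :
  ricci_form frame_conn frame_endo p i j
  = sum4 (fun c => sum4 (fun n => sum4 (fun m => curv_coef m n m c p)
      * (sum4 (fun q => Jc c q * th q i p) * th n j p))).
Proof.
  unfold ricci_form, twist.
  transitivity (sum4 (fun k => frame_endo p k i * sum4 (fun c => sum4 (fun n =>
     sum4 (fun m => curv_coef m n m c p) * (th c k p * th n j p))))).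
  { apply sum4_ext; intros k; rewrite frame_ricci; reflexivity. }
  set (r := fun n c => sum4 (fun m => curv_coef m n m c p)).
  change (sum4 (fun k => frame_endo p k i * sum4 (fun c => sum4 (fun n =>
            r n c * (th c k p * th n j p))))
    = sum4 (fun c => sum4 (fun n => r n c * (sum4 (fun q => Jc c q * th q i p) * th n j p)))).
  clearbody r.
  transitivity (sum4 (fun c => sum4 (fun n => r n c
    * (sum4 (fun k => th c k p * frame_endo p k i) * th n j p)))).
  { unfold sum4; ring. }
  apply sum4_ext; intros c; apply sum4_ext; intros n; rewrite th_endo; reflexivity.
Qed.
End Frame.


(** * A completeness criterion *)

Definition gnorm (g : tensor2) (p : pt) (v : ix -> R) : R :=
  sqrt (sum4 (fun i => sum4 (fun j => g p i j * v i * v j))).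

Definition speed (g : tensor2) (c : R -> pt) (t : R) : R :=
  gnorm g (c t) (velocity c t).

Lemma continuous_curve (c : R -> pt) (t : R) :
  (forall i, continuous (fun s => c s i) t) -> continuous c t.
Proof.
  intros H P [e He].
  assert (HL : forall i, locally (t : R_UniformSpace)
                 (fun s : R => ball (c t i : R_UniformSpace) e (c s i))).
  { intros i; exact (H i _ (locally_ball (c t i : R_UniformSpace) e)). }
  generalize (filter_and _ _ (HL i0) (filter_and _ _ (HL i1)
    (filter_and _ _ (HL i2) (HL i3)))).
  unfold filtermap; apply filter_imp; intros s (B0 & B1 & B2 & B3).
  apply He; intros []; assumption.
Qed.

Lemma C1_curve_is_derive c i t :
  C1_curve c -> is_derive (fun s => c s i) t (velocity c t i).
Proof. intros H; apply Derive_correct, H. Qed.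

Lemma C1_curve_continuous c t : C1_curve c -> continuous c t.
Proof.
  intros H; apply continuous_curve; intros i.
  apply (ex_derive_continuous (fun s => c s i)), H.
Qed.

Lemma continuous_sum4 (F : ix -> R -> R) (t : R) :
  (forall i, continuous (F i) t) -> continuous (fun s => sum4 (fun i => F i s)) t.
Proof.
  intros H; unfold sum4.
  apply (continuous_plus (fun s => F i0 s + F i1 s + F i2 s) (F i3)); [| apply H].
  apply (continuous_plus (fun s => F i0 s + F i1 s) (F i2)); [| apply H].
  apply (continuous_plus (F i0) (F i1)); apply H.
Qed.

Lemma speed_continuous g c t :
  riemannian g -> C1_curve c -> continuous (speed g c) t.
Proof.
  intros [Hg _] Hc; unfold speed, gnorm.
  apply (continuous_comp _ sqrt); [| apply continuous_sqrt].
  apply continuous_sum4; intros i; apply continuous_sum4; intros j.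
  assert (Hv : forall k, continuous (fun s => velocity c s k) t) by (intros k; apply Hc).
  apply (continuous_mult (fun s => g (c s) i j * velocity c s i) (fun s => velocity c s j));
    [| apply Hv].
  apply (continuous_mult (fun s => g (c s) i j) (fun s => velocity c s i)); [| apply Hv].
  apply (continuous_comp c (fun p => g p i j)).
  - apply C1_curve_continuous, Hc.
  - apply smooth_continuous, Hg.
Qed.

(** The functions [K * RInt s 0 t - F t] and [K * RInt s 0 t + F t] are
    nondecreasing in [t]. *)
Lemma increment_le_RInt (F F' s : R -> R) K T :
  (forall t, is_derive F t (F' t)) -> (forall t, continuous s t) -> 0 <= T ->
  (forall t, 0 <= t <= T -> Rabs (F' t) <= K * s t) ->
  Rabs (F T - F 0) <= K * RInt s 0 T.
Proof.
  intros HF Hs HT Hb.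
  assert (DI : forall t, is_derive (fun t => RInt s 0 t) t (s t)).
  { intros t; apply (is_derive_RInt s (fun t => RInt s 0 t) 0); [| apply Hs].
    exists posreal_one; intros b _; apply (RInt_correct (V := R_CompleteNormedModule)).
    apply (ex_RInt_continuous (V := R_CompleteNormedModule)); intros; apply Hs. }
  assert (H : forall e : R, e = 1 \/ e = -1 -> e * (F T - F 0) <= K * RInt s 0 T).
  { intros e He.
    assert (D : forall t, is_derive (fun t => K * RInt s 0 t - e * F t) t (K * s t - e * F' t)).
    { intros t; apply (is_derive_minus (fun t => K * RInt s 0 t) (fun t => e * F t));
        apply is_derive_scal; [apply DI | apply HF]. }
    destruct (MVT_gen (fun t => K * RInt s 0 t - e * F t) 0 T (fun t => K * s t - e * F' t))
      as (x & Hx & E).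
    - intros; apply D.
    - intros; apply continuity_pt_filterlim.
      apply (ex_derive_continuous (fun t => K * RInt s 0 t - e * F t)); eexists; apply D.
    - rewrite Rmin_left, Rmax_right in Hx by lra.
      cbv beta in E; rewrite RInt_point in E; unfold zero in E; simpl in E.
      assert (0 <= (K * s x - e * F' x) * (T - 0)).
      { apply Rmult_le_pos; [| lra].
        specialize (Hb x Hx); revert Hb; unfold Rabs.
        destruct (Rcase_abs (F' x)), He; subst; lra. }
      lra. }
  assert (H1 := H 1 (or_introl eq_refl)); assert (H2 := H (-1) (or_intror eq_refl)).
  unfold Rabs; destruct (Rcase_abs (F T - F 0)); lra.
Qed.

Lemma gnorm_pos g p v : 0 <= gnorm g p v.
Proof. apply sqrt_pos. Qed.

Lemma ex_RInt_speed g c a b : riemannian g -> C1_curve c -> ex_RInt (speed g c) a b.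
Proof.
  intros Hg Hc; apply (ex_RInt_continuous (V := R_CompleteNormedModule)); intros t _.
  apply speed_continuous; assumption.
Qed.

Lemma RInt_speed_le_length g c T :
  riemannian g -> C1_curve c -> 0 <= T <= 1 ->
  0 <= RInt (speed g c) 0 T <= length g c.
Proof.
  intros Hg Hc HT.
  assert (P : forall a b, a <= b -> 0 <= RInt (speed g c) a b).
  { intros a b Hab; apply RInt_ge_0; [exact Hab | apply ex_RInt_speed; assumption |].
    intros; apply gnorm_pos. }
  split; [apply P; lra |].
  change (length g c) with (RInt (speed g c) 0 1).
  rewrite <- (RInt_Chasles (V := R_CompleteNormedModule) (speed g c) 0 T 1)
    by (apply ex_RInt_speed; assumption).
  assert (Q := P T 1 (proj2 HT)); unfold plus; simpl; lra.
Qed.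

Lemma joined_pos g p q L : riemannian g -> joined g p q L -> 0 <= L.
Proof.
  intros Hg; induction 1 as [p | c q L Hc _ IH]; [lra |].
  assert (H := RInt_speed_le_length g c 1 Hg Hc); lra.
Qed.

Definition segment (p q : pt) : R -> pt := fun t i => p i + t * (q i - p i).

Lemma segment_velocity p q t i :
  is_derive (fun s => segment p q s i) t (q i - p i).
Proof. unfold segment; auto_derive; [exact I | ring]. Qed.

Lemma segment_C1 p q : C1_curve (segment p q).
Proof.
  intros i t; split; [eexists; apply segment_velocity |].
  apply (continuous_ext (fun _ => q i - p i)); [| apply continuous_const].
  intros s; symmetry; apply is_derive_unique, segment_velocity.
Qed.

Lemma segment_joined g p q : joined g p q (length g (segment p q)).
Proof.
  rewrite <- (Rplus_0_r (length g (segment p q))).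
  assert (E0 : segment p q 0 = p)
    by (apply functional_extensionality; intros i; unfold segment; ring).
  assert (E1 : segment p q 1 = q)
    by (apply functional_extensionality; intros i; unfold segment; ring).
  rewrite <- E0 at 1.
  apply (joined_step g (segment p q) q 0); [apply segment_C1 |].
  rewrite E1; apply joined_refl.
Qed.

(** The infimum is finite, the points being joined by a segment and lengths
    being nonnegative; otherwise [real] would replace it by 0. *)
Lemma dist_finite g p q :
  riemannian g ->
  is_glb_Rbar (fun L => joined g p q L) (Defs.dist g p q) /\ 0 <= Defs.dist g p q.
Proof.
  intros Hg.
  destruct (Glb_Rbar_correct (fun L => joined g p q L)) as [H1 H2].
  assert (H0 : Rbar_le 0 (Glb_Rbar (fun L => joined g p q L))).
  { apply H2; intros L HL; exact (joined_pos _ _ _ _ Hg HL). }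
  specialize (H1 _ (segment_joined g p q)) as HU.
  unfold Defs.dist.
  destruct (Glb_Rbar (fun L => joined g p q L)) as [d | |]; simpl in *; try contradiction.
  split; [split; assumption | exact H0].
Qed.

Lemma dist_le g p q L : riemannian g -> joined g p q L -> Defs.dist g p q <= L.
Proof. intros Hg HL; apply (proj1 (dist_finite g p q Hg)); exact HL. Qed.

Lemma dist_lt_joined g p q e :
  riemannian g -> Defs.dist g p q < e -> exists L, joined g p q L /\ L < e.
Proof.
  intros Hg He.
  destruct (Classical_Prop.classic (exists L, joined g p q L /\ L < e)) as [H | H]; [exact H |].
  exfalso; destruct (proj1 (dist_finite g p q Hg)) as [_ H2].
  specialize (H2 e); simpl in H2.
  apply Rlt_not_le in He; apply He, H2.
  intros L HL; simpl; apply Rnot_lt_le; intros HLe; apply H; exists L; auto.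
Qed.

Lemma tensor_locally_bounded (g : tensor2) p :
  (forall i j, continuous (fun q => g q i j) p) ->
  exists d M, 0 < d /\ 0 <= M /\
    forall q, (forall i, Rabs (q i - p i) < d) -> forall i j, Rabs (g q i j) <= M.
Proof.
  intros Hg.
  assert (H1 : forall i j, locally p (fun q : pt => Rabs (g q i j) <= Rabs (g p i j) + 1)).
  { intros i j.
    generalize (Hg i j _ (locally_ball (g p i j : R_UniformSpace) posreal_one)).
    unfold filtermap; apply filter_imp; intros q Hq.
    change (Rabs (g q i j - g p i j) < 1) in Hq.
    replace (g q i j) with (g p i j + (g q i j - g p i j)) by ring.
    eapply Rle_trans; [apply Rabs_triang | lra]. }
  assert (H2 : forall P : ix -> pt -> Prop,
    (forall i, locally p (P i)) -> locally p (fun q => forall i, P i q)).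
  { intros P HP.
    generalize (filter_and _ _ (HP i0) (filter_and _ _ (HP i1)
      (filter_and _ _ (HP i2) (HP i3)))).
    apply filter_imp; intros q (B0 & B1 & B2 & B3) []; assumption. }
  destruct (H2 _ (fun i => H2 _ (H1 i))) as [d Hd].
  set (S := sum4 (fun i => sum4 (fun j => Rabs (g p i j)))).
  assert (HS : forall i j, Rabs (g p i j) <= S /\ 0 <= S).
  { assert (A : forall i j, 0 <= Rabs (g p i j)) by (intros; apply Rabs_pos).
    intros i j; unfold S, sum4.
    generalize (A i0 i0) (A i0 i1) (A i0 i2) (A i0 i3) (A i1 i0) (A i1 i1) (A i1 i2)
      (A i1 i3) (A i2 i0) (A i2 i1) (A i2 i2) (A i2 i3) (A i3 i0) (A i3 i1) (A i3 i2) (A i3 i3).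
    destruct i, j; lra. }
  exists d, (S + 1); split; [apply cond_pos | split].
  - generalize (HS i0 i0); lra.
  - intros q Hq i j.
    assert (B := Hd q Hq i j); cbv beta in B.
    generalize (HS i j); lra.
Qed.

Lemma Rabs_sum4 f : Rabs (sum4 f) <= sum4 (fun i => Rabs (f i)).
Proof.
  unfold sum4.
  generalize (Rabs_triang (f i0 + f i1 + f i2) (f i3))
    (Rabs_triang (f i0 + f i1) (f i2)) (Rabs_triang (f i0) (f i1)); lra.
Qed.

Lemma sum4_le f g : (forall i, f i <= g i) -> sum4 f <= sum4 g.
Proof. intros H; unfold sum4; repeat apply Rplus_le_compat; apply H. Qed.

(** Near [p] the metric coefficients are bounded, by [M] say, and the
    straight segment has length at most [4 * sqrt M] times the sup distance. *)
Lemma dist_le_coords g p :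
  riemannian g -> exists d A, 0 < d /\ 0 <= A /\
    forall q m, m < d -> (forall i, Rabs (q i - p i) <= m) -> Defs.dist g q p <= A * m.
Proof.
  intros Hg.
  destruct (tensor_locally_bounded g p) as (d & M & Hd & HM & HB).
  { intros i j; apply smooth_continuous, Hg. }
  exists d, (sqrt (16 * M)); split; [exact Hd | split; [apply sqrt_pos |]].
  intros q m Hm Hq.
  assert (m0 : 0 <= m) by (eapply Rle_trans; [apply Rabs_pos | apply (Hq i0)]).
  eapply Rle_trans; [apply dist_le; [exact Hg | apply segment_joined] |].
  change (length g (segment q p)) with (RInt (speed g (segment q p)) 0 1).
  replace (sqrt (16 * M) * m) with (RInt (fun _ : R => sqrt (16 * M) * m) 0 1)
    by (rewrite RInt_const; unfold scal; simpl; unfold mult; simpl; ring).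
  apply RInt_le; [lra | | apply ex_RInt_const |].
  { apply ex_RInt_speed; [exact Hg | apply segment_C1]. }
  intros t Ht; unfold speed, gnorm.
  rewrite <- (sqrt_pow2 m m0) at 1; rewrite <- sqrt_mult_alt by lra.
  apply sqrt_le_1_alt.
  assert (Hv : forall i, velocity (segment q p) t i = p i - q i)
    by (intros i; apply is_derive_unique, segment_velocity).
  assert (Hin : forall i, Rabs (segment q p t i - p i) < d).
  { intros i; apply Rle_lt_trans with m; [| exact Hm].
    apply Rle_trans with (Rabs (q i - p i)); [| apply Hq].
    unfold segment; replace (q i + t * (p i - q i) - p i) with ((1 - t) * (q i - p i)) by ring.
    rewrite Rabs_mult, (Rabs_pos_eq (1 - t)) by lra.
    generalize (Rabs_pos (q i - p i)); nra. }
  assert (Hm2 : forall i, Rabs (p i - q i) <= m).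
  { intros i; rewrite Rabs_minus_sym; apply Hq. }
  eapply Rle_trans; [apply RRle_abs |].
  eapply Rle_trans; [apply Rabs_sum4 |].
  apply Rle_trans with (sum4 (fun i => sum4 (fun j => M * m * m))).
  2: unfold sum4; simpl; lra.
  apply sum4_le; intros i.
  eapply Rle_trans; [apply Rabs_sum4 |].
  apply sum4_le; intros j.
  rewrite !Hv, !Rabs_mult.
  assert (H1 := HB _ Hin i j).
  apply Rmult_le_compat; [| apply Rabs_pos | | apply Hm2].
  - apply Rmult_le_pos; apply Rabs_pos.
  - apply Rmult_le_compat; [apply Rabs_pos | apply Rabs_pos | exact H1 | apply Hm2].
Qed.

Section Exhaustion.
Variables (g : tensor2) (W : pt -> R) (K : R).
Hypothesis Hg : riemannian g.
Hypothesis HW : smooth W.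
Hypothesis HK : 0 <= K.
Hypothesis W_lip : forall p v, Rabs (sum4 (fun i => partial i W p * v i)) <= K * gnorm g p v.

Lemma W_curve c T :
  C1_curve c -> 0 <= T <= 1 -> W (c T) <= W (c 0) + K * RInt (speed g c) 0 T.
Proof.
  intros Hc HT.
  assert (H := increment_le_RInt (fun t => W (c t))
    (fun t => sum4 (fun i => partial i W (c t) * velocity c t i)) (speed g c) K T).
  cbv beta in H; apply Rabs_le_between in H; [lra | | | lra |].
  - intros t; apply is_derive_curve; [apply HW |].
    intros i; apply C1_curve_is_derive, Hc.
  - intros t; apply speed_continuous; assumption.
  - intros t _; apply W_lip.
Qed.

Lemma W_joined p q L : joined g p q L -> W q <= W p + K * L.
Proof.
  induction 1 as [p | c q L Hc _ IH]; [lra |].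
  assert (H := W_curve c 1 Hc); change (RInt (speed g c) 0 1) with (length g c) in H; lra.
Qed.

(** A curve that starts with [W + K * L <= B] and has length [L] cannot leave the
    sublevel set [W <= B], so the estimate valid there applies all along it. *)
Lemma coord_joined B C i p q L :
  (forall p v, W p <= B -> Rabs (v i) <= C * gnorm g p v) ->
  joined g p q L -> W p + K * L <= B -> Rabs (q i - p i) <= C * L.
Proof.
  intros HC; induction 1 as [p | c q L Hc HJ IH]; intros HB.
  - rewrite Rminus_diag, Rabs_R0; lra.
  - assert (HL := joined_pos _ _ _ _ Hg HJ).
    assert (H1 := W_curve c 1 Hc); change (RInt (speed g c) 0 1) with (length g c) in H1.
    assert (H2 : Rabs (c 1 i - c 0 i) <= C * RInt (speed g c) 0 1).
    { apply (increment_le_RInt (fun t => c t i) (fun t => velocity c t i)); try lra.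
      - intros t; apply C1_curve_is_derive, Hc.
      - intros t; apply speed_continuous; assumption.
      - intros t Ht; apply HC.
        assert (H2 := W_curve c t Hc Ht).
        assert (H3 := RInt_speed_le_length g c t Hg Hc Ht).
        nra. }
    change (RInt (speed g c) 0 1) with (length g c) in H2.
    assert (H3 : Rabs (q i - c 1 i) <= C * L) by (apply IH; nra).
    replace (q i - c 0 i) with ((q i - c 1 i) + (c 1 i - c 0 i)) by ring.
    eapply Rle_trans; [apply Rabs_triang | lra].
Qed.

(** A Cauchy sequence stays in a sublevel set of [W], and so do short curves
    between its terms; there the distance controls the coordinates, which
    therefore converge, and by [dist_le_coords] convergence of the coordinates is
    convergence for the distance. *)
Theorem complete_of_exhaustion :
  (forall B, exists C, forall p v i, W p <= B -> Rabs (v i) <= C * gnorm g p v) ->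
  complete g.
Proof.
  intros Hloc u Hu.
  destruct (Hu 1 Rlt_0_1) as [N1 HN1].
  assert (HWu : forall n, (N1 <= n)%nat -> W (u n) <= W (u N1) + K).
  { intros n Hn.
    destruct (dist_lt_joined g (u N1) (u n) 1 Hg (HN1 N1 n (le_n _) Hn)) as (L & HJ & HL).
    apply W_joined in HJ; nra. }
  destruct (Hloc (W (u N1) + K + K)) as [C0 HC0].
  (* A positive bound, as it is divided by below. *)
  set (C := Rabs C0 + 1).
  assert (C0C : C0 <= C) by (unfold C; generalize (RRle_abs C0); lra).
  assert (Cpos : 0 < C) by (unfold C; generalize (Rabs_pos C0); lra).
  assert (Hlim : forall i, ex_finite_lim_seq (fun n => u n i)).
  { intros i; apply ex_lim_seq_cauchy_corr; intros [e He]; simpl.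
    destruct (Hu (Rmin 1 (e / C))) as [N2 HN2].
    { apply Rmin_pos; [lra | apply Rdiv_lt_0_compat; lra]. }
    exists (max N1 N2); intros n m Hn Hm.
    destruct (dist_lt_joined g (u m) (u n) _ Hg (HN2 m n ltac:(lia) ltac:(lia)))
      as (L & HJ & HL).
    assert (HL0 := joined_pos _ _ _ _ Hg HJ).
    assert (HL1 : L < 1) by (eapply Rlt_le_trans; [exact HL | apply Rmin_l]).
    assert (HL2 : L < e / C) by (eapply Rlt_le_trans; [exact HL | apply Rmin_r]).
    assert (Hb : Rabs (u n i - u m i) <= C0 * L).
    { apply (coord_joined (W (u N1) + K + K) C0 i (u m) (u n) L); [| exact HJ |].
      - intros p v; apply HC0.
      - assert (H := HWu m ltac:(lia)); nra. }
    apply Rle_lt_trans with (C * L); [nra |].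
    apply Rmult_lt_compat_l with (r := C) in HL2; [| exact Cpos].
    replace (C * (e / C)) with e in HL2 by (field; lra); exact HL2. }
  exists (fun i => real (Lim_seq (fun n => u n i))).
  set (p := fun i => real (Lim_seq (fun n => u n i))).
  assert (Hp : forall i e, 0 < e -> eventually (fun n => Rabs (u n i - p i) < e)).
  { intros i e He.
    assert (H := Lim_seq_correct' _ (Hlim i)); apply is_lim_seq_spec in H.
    exact (H (mkposreal e He)). }
  destruct (dist_le_coords g p Hg) as (d & A & Hd & HA & HdA).
  apply is_lim_seq_spec; intros [e He]; simpl.
  set (m := Rmin (d / 2) (e / (A + 1) / 2)).
  assert (Hm : 0 < m).
  { apply Rmin_pos; [lra |]; apply Rdiv_lt_0_compat; [| lra].
    apply Rdiv_lt_0_compat; lra. }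
  generalize (filter_and _ _ (Hp i0 m Hm) (filter_and _ _ (Hp i1 m Hm)
    (filter_and _ _ (Hp i2 m Hm) (Hp i3 m Hm)))).
  apply filter_imp; intros n (B0 & B1 & B2 & B3).
  rewrite Rminus_0_r, Rabs_pos_eq by (apply dist_finite, Hg).
  apply Rle_lt_trans with (A * m).
  - apply HdA.
    + apply Rle_lt_trans with (d / 2); [apply Rmin_l | lra].
    + intros []; left; assumption.
  - assert (m2 : m <= e / (A + 1) / 2) by apply Rmin_r.
    assert (m3 : (A + 1) * m <= e / 2).
    { apply Rmult_le_compat_l with (r := A + 1) in m2; [| lra].
      replace ((A + 1) * (e / (A + 1) / 2)) with (e / 2) in m2 by (field; lra); exact m2. }
    lra.
Qed.
End Exhaustion.


(** * Smooth functions of one variable and of the polar radius *)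

(** Functions on R are regarded as functions on R^4 of the first coordinate, so
    that the closure properties of [Ck] apply to them. *)
Definition line (f : R -> R) : pt -> R := fun p => f (p i0).

Lemma line_Ck_S k (f f' : R -> R) :
  (forall x, is_derive f x (f' x)) -> Ck k (line f') -> Ck (S k) (line f).
Proof.
  intros Hd Hf.
  assert (Hp : forall i p, has_partial i (line f) p /\
                partial i (line f) p = f' (p i0) * delta i i0).
  { intros i p; rewrite <- (partial_coord i i0 p).
    apply (partial_comp i f (fun q => q i0)); [| apply Hd].
    apply smooth_has_partial, smooth_coord. }
  split; [| split].
  - intros p; apply (continuous_comp (fun q : pt => q i0) f).
    + apply continuous_coord.
    + apply (ex_derive_continuous f); eexists; apply Hd.
  - intros i p; apply Hp.
  - intros i; replace (partial i (line f)) with (fun p => line f' p * delta i i0).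
    + apply (Ck_mult k (line f') (fun _ => delta i i0)); [exact Hf | apply Ck_const].
    + apply functional_extensionality; intros p; symmetry; apply Hp.
Qed.

Lemma line_Ck_Derive k f :
  Ck (S k) (line f) ->
  (forall x, is_derive f x (Derive f x)) /\ Ck k (line (Derive f)).
Proof.
  intros [_ [Hd Hk]]; split.
  - intros x; apply Derive_correct.
    exact (Hd i0 (fun _ => x)).
  - exact (Hk i0).
Qed.

Lemma line_continuous k f x : Ck k (line f) -> continuous f x.
Proof.
  intros H; apply (Ck_continuous _ _ (fun _ => x)) in H.
  apply (continuous_comp (fun t : R => (fun _ => t) : pt) (line f) x); [| exact H].
  intros P [e He]; exists e; intros y Hy; apply He; intros i; exact Hy.
Qed.

Lemma smooth_line_Derive f :
  smooth (line f) -> (forall x, is_derive f x (Derive f x)) /\ smooth (line (Derive f)).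
Proof.
  intros H; split; [apply (line_Ck_Derive 0), H |].
  intros k; apply line_Ck_Derive, H.
Qed.

Definition moment (j : nat) (f : R -> R) (r : R) : R :=
  RInt (fun t => t ^ j * f (r * t)) 0 1.

Lemma is_derive_moment j (f f' : R -> R) (r : R) :
  (forall x, is_derive f x (f' x)) -> (forall x, continuous f' x) ->
  is_derive (moment j f) r (moment (S j) f' r).
Proof.
  intros Hf Hc.
  assert (D : forall t y, is_derive (fun u => t ^ j * f (u * t)) y (t ^ S j * f' (y * t))).
  { intros t y; replace (t ^ S j * f' (y * t)) with (t ^ j * (t * f' (y * t)))
      by (simpl; ring).
    apply is_derive_scal.
    apply (is_derive_comp f (fun u => u * t)); [apply Hf |].
    auto_derive; [exact I | ring]. }
  replace (moment (S j) f' r)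
    with (RInt (fun t => Derive (fun u => t ^ j * f (u * t)) r) 0 1).
  2:{ apply RInt_ext; intros t _; apply is_derive_unique, D. }
  apply is_derive_RInt_param.
  - exists posreal_one; intros y _ t _; eexists; apply D.
  - intros t _.
    apply continuity_2d_pt_ext with (fun u v => v ^ S j * f' (u * v)).
    { intros u v; symmetry; apply is_derive_unique, D. }
    apply continuity_2d_pt_filterlim.
    apply (continuous_mult (fun z : R * R => snd z ^ S j) (fun z => f' (fst z * snd z)) (r, t)).
    + apply (continuous_comp snd (fun x => x ^ S j)).
      * apply continuous_snd.
      * apply (ex_derive_continuous (fun x => x ^ S j)); auto_derive; exact I.
    + apply (continuous_comp (fun z : R * R => fst z * snd z) f').
      * apply (continuous_mult (fun z : R * R => fst z) (fun z => snd z));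
          [apply continuous_fst | apply continuous_snd].
      * apply Hc.
  - exists posreal_one; intros y _; apply (ex_RInt_continuous (V := R_CompleteNormedModule)); intros t _.
    apply (continuous_mult (fun t => t ^ j) (fun t => f (y * t))).
    + apply (ex_derive_continuous (fun x => x ^ j)); auto_derive; exact I.
    + apply (continuous_comp (fun t => y * t) f).
      * apply (ex_derive_continuous (fun t => y * t)); auto_derive; exact I.
      * apply (ex_derive_continuous f); eexists; apply Hf.
Qed.

(** Each derivative under the integral raises the power of [t] by one, so all
    powers are needed for the induction. *)
Lemma Ck_moment k : forall j f, Ck (S k) (line f) -> Ck k (line (moment j f)).
Proof.
  induction k as [| k IH]; intros j f Hf;
    destruct (line_Ck_Derive _ _ Hf) as [Hd Hf'];
    assert (Hm : forall r, is_derive (moment j f) r (moment (S j) (Derive f) r))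
      by (intros r; apply is_derive_moment; [exact Hd | intros x; eapply line_continuous, Hf']).
  - split; [| exact I].
    intros p; apply (continuous_comp (fun q : pt => q i0) (moment j f)).
    + apply continuous_coord.
    + apply (ex_derive_continuous (moment j f)); eexists; apply Hm.
  - apply line_Ck_S with (moment (S j) (Derive f)); [exact Hm | apply IH, Hf'].
Qed.

(** Hadamard's quotient [(f r - f 0) / r], in a form that makes sense and is
    smooth at 0. *)
Definition slope (f : R -> R) : R -> R := moment 0 (Derive f).

Lemma smooth_slope f : smooth (line f) -> smooth (line (slope f)).
Proof.
  intros H k.
  exact (Ck_moment k 0 (Derive f) (proj2 (smooth_line_Derive f H) (S k))).
Qed.

Lemma slope_spec f r : smooth (line f) -> r * slope f r = f r - f 0.
Proof.
  intros H; destruct (smooth_line_Derive f H) as [Hd Hf'].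
  assert (C : forall t, continuous (fun t => Derive f (r * t)) t).
  { intros t; apply (continuous_comp (fun t => r * t) (Derive f)).
    - apply (ex_derive_continuous (fun t => r * t)); auto_derive; exact I.
    - apply (line_continuous 0), Hf'. }
  unfold slope, moment.
  transitivity (RInt (fun t => r * Derive f (r * t)) 0 1).
  { transitivity (RInt (fun t => scal r (t ^ 0 * Derive f (r * t))) 0 1).
    - symmetry; apply (RInt_scal (V := R_CompleteNormedModule)).
      apply (ex_RInt_continuous (V := R_CompleteNormedModule)); intros t _.
      apply (continuous_ext (fun t => Derive f (r * t))); [| apply C].
      intros s; simpl; ring.
    - apply RInt_ext; intros t _; unfold scal; simpl; unfold mult; simpl; ring. }
  replace (f r - f 0) with (minus ((fun t => f (r * t)) 1) ((fun t => f (r * t)) 0))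
    by (cbv beta; rewrite Rmult_1_r, Rmult_0_r; reflexivity).
  apply (is_RInt_unique (V := R_CompleteNormedModule)).
  apply (is_RInt_derive (V := R_CompleteNormedModule) (fun t => f (r * t))).
  - intros t _.
    apply (is_derive_comp f (fun t => r * t)); [apply Hd |].
    auto_derive; [exact I | ring].
  - intros t _; apply (continuous_mult (fun _ => r)); [apply continuous_const | apply C].
Qed.

Definition even_fun (f : R -> R) : Prop := forall x, f (- x) = f x.
Definition odd_fun (f : R -> R) : Prop := forall x, f (- x) = - f x.

Lemma is_derive_reflect (f f' : R -> R) (x : R) :
  (forall y, is_derive f y (f' y)) -> is_derive (fun t => f (- t)) x (- f' (- x)).
Proof.
  intros H; replace (- f' (- x)) with (-1 * f' (- x)) by ring.
  apply (is_derive_comp f Ropp); [apply H | auto_derive; [exact I | ring]].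
Qed.

Lemma odd_Derive f : (forall x, ex_derive f x) -> even_fun f -> odd_fun (Derive f).
Proof.
  intros Hd H x.
  assert (D : is_derive f x (- Derive f (- x))).
  { apply is_derive_ext with (fun t => f (- t)); [intros t; apply H |].
    apply is_derive_reflect; intros y; apply Derive_correct, Hd. }
  rewrite (is_derive_unique _ _ _ D); ring.
Qed.

Lemma even_slope f : (forall x, ex_derive f x) -> odd_fun f -> even_fun (slope f).
Proof.
  intros Hd H r; unfold slope, moment; apply RInt_ext; intros t _.
  assert (D : is_derive f (r * t) (Derive f (- r * t))).
  { apply is_derive_ext with (fun t => - f (- t)); [intros s; rewrite H; Rring |].
    replace (Derive f (- r * t)) with (- (- Derive f (- (r * t))))
      by (rewrite Ropp_involutive; f_equal; ring).
    apply (is_derive_opp (fun t => f (- t))), is_derive_reflect.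
    intros y; apply Derive_correct, Hd. }
  rewrite (is_derive_unique _ _ _ D); reflexivity.
Qed.

Definition radial (e : R -> R) : pt -> R := fun p => e (sqrt (p i2 ^ 2 + p i3 ^ 2)).

(** At the origin the square root is not differentiable, but there the slice is
    [t |-> e |t|], which is [e] itself by evenness, and [e' 0 = 0]. *)
Lemma is_derive_radial_slice e (v u : R) :
  smooth (line e) -> even_fun e ->
  is_derive (fun t => e (sqrt (t ^ 2 + v ^ 2))) u
    (u * slope (Derive e) (sqrt (u ^ 2 + v ^ 2))).
Proof.
  intros He Hev.
  destruct (smooth_line_Derive e He) as [Hd He'].
  assert (H0 : Derive e 0 = 0).
  { assert (O := odd_Derive e (fun x => ex_intro _ _ (Hd x)) Hev 0).
    rewrite Ropp_0 in O; lra. }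
  destruct (Req_dec (u ^ 2 + v ^ 2) 0) as [Z | NZ].
  - assert (u = 0) by nra; assert (v = 0) by nra; subst.
    rewrite Rmult_0_l.
    apply is_derive_ext with e; [| rewrite <- H0 at 2; apply Hd].
    intros t; replace (t ^ 2 + 0 ^ 2) with (Rsqr t) by (unfold Rsqr; ring).
    rewrite sqrt_Rsqr_abs; unfold Rabs; destruct (Rcase_abs t); [symmetry; apply Hev | reflexivity].
  - assert (P : 0 < u ^ 2 + v ^ 2) by nra.
    assert (Q := sqrt_lt_R0 _ P).
    set (r := sqrt (u ^ 2 + v ^ 2)) in *.
    assert (S := slope_spec (Derive e) r He'); rewrite H0 in S.
    replace (u * slope (Derive e) r) with (u / r * Derive e r)
      by (replace (Derive e r) with (r * slope (Derive e) r) by lra; field; lra).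
    apply (is_derive_comp e (fun t => sqrt (t ^ 2 + v ^ 2))); [apply Hd |].
    auto_derive; [exact P |]; fold r.
    replace (u * (u * 1) + v * (v * 1)) with (u ^ 2 + v ^ 2) by ring.
    fold r; field; lra.
Qed.

Lemma partial_radial e i p :
  smooth (line e) -> even_fun e ->
  has_partial i (radial e) p /\
  partial i (radial e) p =
    (delta i i2 * p i2 + delta i i3 * p i3) * radial (slope (Derive e)) p.
Proof.
  intros He Hev; unfold has_partial, partial, radial.
  match goal with |- ex_derive ?f ?x /\ Derive _ _ = ?l =>
    assert (D : is_derive f x l) end.
  { destruct i; unfold upd, delta; simpl ix_eq_dec; cbv iota.
    - replace ((0 * p i2 + 0 * p i3) * _) with 0 by ring.
      exact (is_derive_const (K := R_AbsRing) (V := R_NormedModule) (radial e p) (p i0)).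
    - replace ((0 * p i2 + 0 * p i3) * _) with 0 by ring.
      exact (is_derive_const (K := R_AbsRing) (V := R_NormedModule) (radial e p) (p i1)).
    - replace (1 * p i2 + 0 * p i3) with (p i2) by ring.
      apply is_derive_radial_slice; assumption.
    - replace (0 * p i2 + 1 * p i3) with (p i3) by ring.
      rewrite (Rplus_comm (p i2 ^ 2)).
      eapply is_derive_ext; [| apply is_derive_radial_slice; assumption].
      intros t; cbn; f_equal; f_equal; ring. }
  split; [eexists; exact D | apply is_derive_unique, D].
Qed.

(** The gradient of [radial e] is [(u, v)] times the function [e' r / r] of the
    radius, which is again smooth and even; hence the class of such functions
    allows an induction on the order of differentiability. *)
Lemma smooth_radial e : smooth (line e) -> even_fun e -> smooth (radial e).
Proof.
  intros He Hev k; revert e He Hev; induction k as [| k IH]; intros e He Hev.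
  all: assert (C : forall p, continuous (radial e) p).
  1, 3: intros p; apply (continuous_comp (fun q : pt => sqrt (q i2 ^ 2 + q i3 ^ 2)) e);
    [| apply (line_continuous 0), He];
    apply (continuous_comp (fun q : pt => q i2 ^ 2 + q i3 ^ 2) sqrt);
    [| apply continuous_sqrt];
    apply smooth_continuous, smooth_plus;
    simpl; repeat (apply smooth_mult || apply smooth_coord || apply smooth_const).
  - split; [exact C | exact I].
  - split; [exact C | split].
    + intros i p; apply partial_radial; assumption.
    + intros i.
      replace (partial i (radial e)) with
        (fun p => (delta i i2 * p i2 + delta i i3 * p i3) * radial (slope (Derive e)) p).
      * apply Ck_mult.
        -- apply Ck_plus; apply (Ck_mult k (fun _ => _)); auto using Ck_const, Ck_coord.
        -- destruct (smooth_line_Derive e He) as [Hd He'].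
           destruct (smooth_line_Derive _ He') as [Hd' _].
           apply IH; [apply smooth_slope, He' |].
           apply even_slope; [intros x; eexists; apply Hd' |].
           apply odd_Derive; [intros x; eexists; apply Hd | exact Hev].
      * apply functional_extensionality; intros p; symmetry.
        apply partial_radial; assumption.
Qed.

(** * The profile of the metric *)

(** The theorem on an interval applies around [r], because the monotonicity of [f]
    bounds [h] there. *)
Lemma is_derive_inverse (f f' h : R -> R) :
  (forall t, is_derive f t (f' t)) -> (forall t, 0 < f' t) -> (forall r, f (h r) = r) ->
  forall r, is_derive h r (/ f' (h r)).
Proof.
  intros Hd Hp Hh r.
  assert (Inc : forall s t, s < t -> f s < f t).
  { intros s t Hst; apply (incr_function f m_infty p_infty f'); simpl; auto; intros; apply Hp. }
  assert (Inv : forall s t, f s < f t -> s < t).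
  { intros s t Hst; destruct (Rlt_or_le s t) as [| [L | ->]]; [assumption | |].
    - specialize (Inc _ _ L); lra.
    - lra. }
  assert (Cf : forall a, continuity_pt f a).
  { intros a; apply continuity_pt_filterlim, (ex_derive_continuous f); eexists; apply Hd. }
  assert (Hinc : forall x y, x <= y -> h x <= h y).
  { intros x y Hxy; apply Rnot_lt_le; intros L; apply Inc in L; rewrite !Hh in L; lra. }
  assert (Ch : continuity_pt h r).
  { apply (continuity_pt_recip_interv f h (h r - 1) (h r + 1)).
    - lra.
    - intros; apply Inc; assumption.
    - intros x _ _; apply Hh.
    - intros x H1 H2; split; apply Rnot_lt_le; intros L; apply Inc in L;
        rewrite Hh in L; lra.
    - intros a _; apply Cf.
    - rewrite <- (Hh r) at 2 3; split; apply Inc; lra. }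
  assert (Prf : forall a, h (r - 1) <= a <= h (r + 1) -> derivable_pt f a).
  { intros a _; exists (f' a); apply is_derive_Reals, Hd. }
  assert (Hi : h (r - 1) <= h r <= h (r + 1)) by (split; apply Hinc; lra).
  assert (E : derive_pt f (h r) (Prf (h r) Hi) = f' (h r)).
  { apply derive_pt_eq_0, is_derive_Reals, Hd. }
  apply is_derive_Reals.
  replace (/ f' (h r)) with (1 / derive_pt f (h r) (Prf (h r) Hi))
    by (rewrite E; unfold Rdiv; ring).
  apply derivable_pt_lim_recip_interv; try lra.
  - exact Ch.
  - intros x _; apply Hh.
  - rewrite E; apply Rgt_not_eq, Hp.
Qed.

(** The square root of [phi] in terms of [t = e^q]. *)
Definition warp (c1 t : R) : R := sqrt (sqrt (t ^ 2 + c1 ^ 2)).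

(** The distance to the singular orbit in terms of [t = e^q], as [dt / warp] is
    the arc length of the orthogonal curves (see [radius_arc]). *)
Definition arc (c1 t : R) : R := RInt (fun s => / warp c1 s) 0 t.

Lemma warp_pos c1 t : 0 < c1 -> 0 < warp c1 t.
Proof. intros H; apply sqrt_lt_R0, sqrt_lt_R0; nra. Qed.

Lemma warp_sqr c1 t : 0 < c1 -> warp c1 t ^ 2 = sqrt (t ^ 2 + c1 ^ 2).
Proof. intros H; apply pow2_sqrt, sqrt_pos. Qed.

Lemma is_derive_warp (c1 t : R) :
  0 < c1 -> is_derive (warp c1) t (t / (2 * warp c1 t ^ 3)).
Proof.
  intros H; assert (W := warp_pos c1 t H); assert (S := warp_sqr c1 t H).
  assert (P : 0 < t ^ 2 + c1 ^ 2) by nra.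
  assert (Q := sqrt_lt_R0 _ P).
  unfold warp; auto_derive.
  - simpl in *; auto.
  - change (t * (t * 1) + c1 * (c1 * 1)) with (t ^ 2 + c1 ^ 2).
    change (sqrt (sqrt (t ^ 2 + c1 ^ 2))) with (warp c1 t).
    rewrite <- S; field; lra.
Qed.

Lemma is_derive_arc (c1 t : R) : 0 < c1 -> is_derive (arc c1) t (/ warp c1 t).
Proof.
  intros H.
  assert (C : forall s, continuous (fun s => / warp c1 s) s).
  { intros s; apply (ex_derive_continuous (fun s => / warp c1 s)).
    eexists; apply is_derive_inv; [apply is_derive_warp, H | apply Rgt_not_eq, warp_pos, H]. }
  apply (is_derive_RInt (fun s => / warp c1 s) (arc c1) 0); [| apply C].
  exists posreal_one; intros b _.
  apply (RInt_correct (V := R_CompleteNormedModule)).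
  apply (ex_RInt_continuous (V := R_CompleteNormedModule)); intros; apply C.
Qed.

Lemma arc_0 c1 : arc c1 0 = 0.
Proof. unfold arc; rewrite RInt_point; reflexivity. Qed.

Lemma arc_inc c1 s t : 0 < c1 -> s < t -> arc c1 s < arc c1 t.
Proof.
  intros H Hst; apply (incr_function (arc c1) m_infty p_infty (fun t => / warp c1 t));
    simpl; auto.
  - intros; apply is_derive_arc, H.
  - intros; apply Rinv_0_lt_compat, warp_pos, H.
Qed.

Lemma arc_odd c1 : 0 < c1 -> odd_fun (arc c1).
Proof.
  intros H t.
  assert (D : forall x, is_derive (fun s => arc c1 (- s) + arc c1 s) x 0).
  { intros x; replace 0 with (- / warp c1 (- x) + / warp c1 x).
    - apply (is_derive_plus (fun s => arc c1 (- s))).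
      + apply (is_derive_reflect (arc c1) (fun x => / warp c1 x)).
        intros y; apply is_derive_arc, H.
      + apply is_derive_arc, H.
    - unfold warp; replace ((- x) ^ 2) with (x ^ 2) by ring; ring. }
  destruct (MVT_gen (fun s => arc c1 (- s) + arc c1 s) 0 t (fun _ => 0)) as (x & _ & E).
  - intros; apply D.
  - intros; apply continuity_pt_filterlim.
    apply (ex_derive_continuous (fun s => arc c1 (- s) + arc c1 s)); eexists; apply D.
  - cbv beta in E; rewrite Ropp_0, arc_0 in E; lra.
Qed.

(** The derivative [t / warp^3] of [2 * warp] is at most [1 / warp], because
    [t <= warp^2]. The bound shows that [arc] is unbounded. *)
Lemma arc_lower c1 t :
  0 < c1 -> 0 <= t -> 2 * (warp c1 t - warp c1 0) <= arc c1 t.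
Proof.
  intros H Ht.
  assert (D : forall x, is_derive (fun s => arc c1 s - 2 * warp c1 s) x
                         (/ warp c1 x - 2 * (x / (2 * warp c1 x ^ 3)))).
  { intros x; apply (is_derive_minus (arc c1) (fun s => 2 * warp c1 s)).
    - apply is_derive_arc, H.
    - apply is_derive_scal, is_derive_warp, H. }
  destruct (MVT_gen (fun s => arc c1 s - 2 * warp c1 s) 0 t _
    (fun x _ => D x)
    (fun x _ => proj2 (continuity_pt_filterlim _ _)
       (ex_derive_continuous (K := R_AbsRing) (V := R_NormedModule) _ _ (ex_intro _ _ (D x)))))
    as (x & _ & E).
  cbv beta in E; rewrite arc_0 in E.
  assert (W := warp_pos c1 x H); assert (S := warp_sqr c1 x H).
  assert (L : x <= warp c1 x ^ 2).
  { rewrite S; apply Rle_trans with (Rabs x); [apply RRle_abs |].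
    rewrite <- sqrt_Rsqr_abs; apply sqrt_le_1_alt; unfold Rsqr; nra. }
  assert (0 <= (/ warp c1 x - 2 * (x / (2 * warp c1 x ^ 3))) * (t - 0)).
  { apply Rmult_le_pos; [| lra].
    replace (/ warp c1 x - 2 * (x / (2 * warp c1 x ^ 3)))
      with ((warp c1 x ^ 2 - x) * / warp c1 x ^ 3) by (field; lra).
    apply Rmult_le_pos; [lra |].
    apply Rlt_le, Rinv_0_lt_compat, pow_lt, W. }
  lra.
Qed.

Lemma arc_surj c1 : 0 < c1 -> forall r, {t | arc c1 t = r}.
Proof.
  intros H r.
  (* Chosen so that [warp c1 T >= sqrt T = Rabs r / 2 + warp c1 0]. *)
  set (T := (Rabs r / 2 + warp c1 0) ^ 2).
  assert (W0 := warp_pos c1 0 H).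
  assert (A := Rabs_pos r).
  assert (HT : 0 <= T) by apply pow2_ge_0.
  assert (L : Rabs r <= arc c1 T).
  { eapply Rle_trans; [| apply arc_lower; assumption].
    assert (Rabs r / 2 + warp c1 0 <= warp c1 T); [| lra].
    unfold warp at 2.
    apply Rle_trans with (sqrt T).
    - unfold T; rewrite sqrt_pow2; lra.
    - apply sqrt_le_1_alt.
      apply Rle_trans with (sqrt (T ^ 2)); [rewrite sqrt_pow2; lra |].
      apply sqrt_le_1_alt; nra. }
  assert (O := arc_odd c1 H T).
  destruct (IVT_gen (arc c1) (- T) T r) as (t & _ & E).
  - intros x; apply continuity_pt_filterlim, (ex_derive_continuous (arc c1)).
    eexists; apply is_derive_arc, H.
  - rewrite O, Rmin_left, Rmax_right by lra.
    revert L; unfold Rabs; destruct (Rcase_abs r); lra.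
  - exists t; exact E.
Qed.

(** The profile gives [e^q] in terms of the distance to the singular orbit; it
    solves the equation [h' = warp h]. *)
Lemma profile_exists c1 : 0 < c1 ->
  exists h, (forall r, arc c1 (h r) = r) /\ (forall t, h (arc c1 t) = t).
Proof.
  intros H; exists (fun r => proj1_sig (arc_surj c1 H r)).
  assert (E : forall r, arc c1 (proj1_sig (arc_surj c1 H r)) = r)
    by (intros r; exact (proj2_sig (arc_surj c1 H r))).
  split; [exact E |].
  intros t; specialize (E (arc c1 t)).
  destruct (Rtotal_order (proj1_sig (arc_surj c1 H (arc c1 t))) t) as [L | [L | L]];
    [| exact L |]; apply (arc_inc c1 _ _ H) in L; lra.
Qed.

Section Profile.
Variables (c1 : R) (h : R -> R).
Hypotheses (hc1 : 0 < c1).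
Hypotheses (arc_h : forall r, arc c1 (h r) = r) (h_arc : forall t, h (arc c1 t) = t).

Lemma is_derive_profile (r : R) : is_derive h r (warp c1 (h r)).
Proof.
  rewrite <- (Rinv_inv (warp c1 (h r))).
  apply (is_derive_inverse (arc c1) (fun t => / warp c1 t)).
  - intros t; apply is_derive_arc, hc1.
  - intros t; apply Rinv_0_lt_compat, warp_pos, hc1.
  - exact arc_h.
Qed.

Lemma profile_odd : odd_fun h.
Proof.
  intros r; rewrite <- (arc_h r) at 1.
  rewrite <- (arc_odd c1 hc1), h_arc; reflexivity.
Qed.

Lemma profile_0 : h 0 = 0.
Proof. rewrite <- (arc_0 c1) at 1; apply h_arc. Qed.

(** Bootstrapping with [h' = warp h]. *)
Lemma smooth_profile : smooth (line h).
Proof.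
  intros k; induction k as [| k IH].
  - split; [| exact I].
    intros p; apply (continuous_comp (fun q : pt => q i0) h); [apply continuous_coord |].
    apply (ex_derive_continuous h); eexists; apply is_derive_profile.
  - apply line_Ck_S with (fun r => warp c1 (h r)); [apply is_derive_profile |].
    unfold line, warp.
    assert (P : forall p : pt, 0 < h (p i0) ^ 2 + c1 ^ 2) by (intros p; nra).
    apply Ck_sqrt; [intros p; apply sqrt_lt_R0, P |].
    apply Ck_sqrt; [exact P |].
    apply (Ck_plus k (fun p => h (p i0) ^ 2) (fun _ => c1 ^ 2)); [| apply Ck_const].
    apply (Ck_mult k (line h)); [exact IH |].
    apply (Ck_mult k (line h)); [exact IH | apply Ck_const].
Qed.
End Profile.


(** * The metric in a moving frame *)

Section Metric.
Variables (c1 : R) (h : R -> R).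
Hypotheses (hc1 : 0 < c1).
Hypotheses (arc_h : forall r, arc c1 (h r) = r) (h_arc : forall t, h (arc c1 t) = t).

Let h_smooth : smooth (line h) := smooth_profile c1 h hc1 arc_h.

(** The factor [h r / r] between the chart coordinates [(u, v)] and
    [(a, b) = (e^q cos z, e^q sin z)]. *)
Definition stretch : pt -> R := radial (slope h).
Definition stretch_der : pt -> R := radial (slope (Derive (slope h))).

Lemma ex_derive_h r : ex_derive h r.
Proof. eexists; apply (is_derive_profile c1 h hc1 arc_h). Qed.

Lemma slope_h_even : even_fun (slope h).
Proof. exact (even_slope h ex_derive_h (profile_odd c1 h hc1 arc_h h_arc)). Qed.

Lemma slope_h_smooth : smooth (line (slope h)).
Proof. exact (smooth_slope h h_smooth). Qed.

Lemma stretch_smooth : smooth stretch.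
Proof. exact (smooth_radial _ slope_h_smooth slope_h_even). Qed.

Lemma partial_stretch i p :
  partial i stretch p = (delta i i2 * p i2 + delta i i3 * p i3) * stretch_der p.
Proof. apply partial_radial; [exact slope_h_smooth | exact slope_h_even]. Qed.

Lemma warp_ge t : sqrt c1 <= warp c1 t.
Proof.
  unfold warp; apply sqrt_le_1_alt.
  rewrite <- (sqrt_pow2 c1) at 1 by lra.
  apply sqrt_le_1_alt; nra.
Qed.

(** The value is the mean of [h' = warp h >= sqrt c1] over a radius. *)
Lemma stretch_ge p : sqrt c1 <= stretch p.
Proof.
  unfold stretch, radial, slope, moment.
  set (r := sqrt (p i2 ^ 2 + p i3 ^ 2)).
  replace (sqrt c1) with (RInt (fun _ : R => sqrt c1) 0 1)
    by (rewrite RInt_const; unfold scal; simpl; unfold mult; simpl; ring).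
  apply RInt_le; [lra | apply ex_RInt_const | |].
  - apply (ex_RInt_continuous (V := R_CompleteNormedModule)); intros t _.
    apply (continuous_mult (fun t => t ^ 0) (fun t => Derive h (r * t))).
    + apply (ex_derive_continuous (fun x => x ^ 0)); auto_derive; exact I.
    + apply (continuous_comp (fun t => r * t) (Derive h)).
      * apply (ex_derive_continuous (fun t => r * t)); auto_derive; exact I.
      * apply (line_continuous 0), (smooth_line_Derive h h_smooth).
  - intros t _; rewrite (is_derive_unique _ _ _ (is_derive_profile c1 h hc1 arc_h (r * t))).
    generalize (warp_ge (h (r * t))); simpl; lra.
Qed.

(** The expression on the right is the derivative [h'] of [r * slope h r]. *)
Lemma stretch_radial_ge p :
  sqrt c1 <= stretch p + (p i2 ^ 2 + p i3 ^ 2) * stretch_der p.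
Proof.
  assert (N : 0 <= p i2 ^ 2 + p i3 ^ 2) by nra.
  unfold stretch, stretch_der, radial.
  set (r := sqrt (p i2 ^ 2 + p i3 ^ 2)).
  replace (p i2 ^ 2 + p i3 ^ 2) with (r * r) by (apply sqrt_sqrt, N).
  destruct (smooth_line_Derive _ slope_h_smooth) as [Hd Hs].
  assert (E0 : Derive (slope h) 0 = 0).
  { assert (O := odd_Derive _ (fun x => ex_intro _ _ (Hd x)) slope_h_even 0).
    rewrite Ropp_0 in O; lra. }
  assert (E1 := slope_spec (Derive (slope h)) r Hs); rewrite E0 in E1.
  assert (D : is_derive h r (slope h r + r * Derive (slope h) r)).
  { apply is_derive_ext with (fun s => s * slope h s).
    { intros s; rewrite (slope_spec h s h_smooth), (profile_0 c1 h h_arc); Rring. }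
    evar_last; [apply (is_derive_mult (fun s => s) (slope h)); [apply is_derive_id | apply Hd |] |].
    - intros; apply Rmult_comm.
    - unfold plus, mult, one; simpl; unfold mult, one; simpl; Rring. }
  assert (D' := is_derive_profile c1 h hc1 arc_h r).
  assert (E2 : slope h r + r * Derive (slope h) r = warp c1 (h r)).
  { rewrite <- (is_derive_unique _ _ _ D); apply is_derive_unique, D'. }
  generalize (warp_ge (h r)); rewrite <- E2; nra.
Qed.

Definition flat2 (p : pt) : R := p i2 * stretch p.
Definition flat3 (p : pt) : R := p i3 * stretch p.
Definition phi_sq (p : pt) : R := flat2 p ^ 2 + flat3 p ^ 2 + c1 ^ 2.
Definition inv_phi_sq (p : pt) : R := / phi_sq p.
Definition phi_chart (p : pt) : R := sqrt (phi_sq p).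

Lemma flat2_smooth : smooth flat2.
Proof. apply smooth_mult; [apply smooth_coord | exact stretch_smooth]. Qed.

Lemma flat3_smooth : smooth flat3.
Proof. apply smooth_mult; [apply smooth_coord | exact stretch_smooth]. Qed.

Lemma phi_sq_smooth : smooth phi_sq.
Proof.
  apply smooth_plus; [apply smooth_plus | apply smooth_const]; apply smooth_sqr;
    [exact flat2_smooth | exact flat3_smooth].
Qed.

Lemma phi_sq_pos p : 0 < phi_sq p.
Proof. unfold phi_sq; nra. Qed.

Lemma phi_chart_pos p : 0 < phi_chart p.
Proof. apply sqrt_lt_R0, phi_sq_pos. Qed.

Lemma phi_chart_smooth : smooth phi_chart.
Proof. exact (smooth_sqrt phi_sq phi_sq_pos phi_sq_smooth). Qed.

Lemma inv_phi_sq_smooth : smooth inv_phi_sq.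
Proof.
  exact (smooth_inv phi_sq (fun p => Rgt_not_eq _ _ (phi_sq_pos p)) phi_sq_smooth).
Qed.

Lemma phi_chart_sq p : phi_chart p ^ 2 = phi_sq p.
Proof. apply pow2_sqrt; left; apply phi_sq_pos. Qed.

Lemma inv_phi_sq_spec p : inv_phi_sq p * phi_chart p ^ 2 = 1.
Proof. rewrite phi_chart_sq; unfold inv_phi_sq; field; apply Rgt_not_eq, phi_sq_pos. Qed.

Lemma partial_flat2 i p :
  partial i flat2 p = delta i i2 * stretch p
    + p i2 * ((delta i i2 * p i2 + delta i i3 * p i3) * stretch_der p).
Proof.
  unfold flat2; rewrite partial_mult_s, partial_coord, partial_stretch; [reflexivity | |];
    [apply smooth_coord | exact stretch_smooth].
Qed.

Lemma partial_flat3 i p :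
  partial i flat3 p = delta i i3 * stretch p
    + p i3 * ((delta i i2 * p i2 + delta i i3 * p i3) * stretch_der p).
Proof.
  unfold flat3; rewrite partial_mult_s, partial_coord, partial_stretch; [reflexivity | |];
    [apply smooth_coord | exact stretch_smooth].
Qed.

Lemma partial_phi_sq i p :
  partial i phi_sq p = 2 * (flat2 p * partial i flat2 p + flat3 p * partial i flat3 p).
Proof.
  assert (Ha := flat2_smooth); assert (Hb := flat3_smooth).
  unfold phi_sq.
  rewrite (partial_plus_s i (fun q => flat2 q ^ 2 + flat3 q ^ 2)), partial_plus_s, !partial_sqr,
    partial_const; auto using smooth_const, smooth_plus, smooth_sqr; ring.
Qed.

Lemma partial_inv_phi_sq i p :
  partial i inv_phi_sq p = -2 * inv_phi_sq p ^ 2 * (flat2 p * partial i flat2 p + flat3 p * partial i flat3 p).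
Proof.
  destruct (partial_comp i Rinv phi_sq p (- / phi_sq p ^ 2)) as [_ E].
  - apply smooth_has_partial, phi_sq_smooth.
  - evar_last; [apply (is_derive_inv (fun x => x)); [apply is_derive_id |] |].
    + apply Rgt_not_eq, phi_sq_pos.
    + assert (N := phi_sq_pos p); unfold one; simpl; field; lra.
  - unfold inv_phi_sq at 1; rewrite E, partial_phi_sq; unfold inv_phi_sq.
    assert (N := phi_sq_pos p); field; lra.
Qed.

Lemma partial_phi_chart i p :
  partial i phi_chart p = phi_chart p * inv_phi_sq p * (flat2 p * partial i flat2 p + flat3 p * partial i flat3 p).
Proof.
  assert (N := phi_sq_pos p); assert (P := phi_chart_pos p); assert (S := phi_chart_sq p).
  destruct (partial_comp i sqrt phi_sq p (/ (2 * phi_chart p))) as [_ E].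
  - apply smooth_has_partial, phi_sq_smooth.
  - evar_last; [apply (is_derive_sqrt (fun x => x)); [apply is_derive_id | exact N] |].
    unfold one; simpl; unfold phi_chart; field; apply Rgt_not_eq, P.
  - unfold phi_chart at 1; rewrite E, partial_phi_sq; unfold inv_phi_sq; rewrite <- S; field; lra.
Qed.

Definition coframe (m j : ix) (p : pt) : R :=
  match m with
  | i0 => delta j i0
  | i1 => delta j i1
  | i2 => partial j flat2 p + flat3 p * p i0 * delta j i1
  | i3 => partial j flat3 p - flat2 p * p i0 * delta j i1
  end.

Definition jac (p : pt) : R :=
  partial i2 flat2 p * partial i3 flat3 p - partial i3 flat2 p * partial i2 flat3 p.

Definition frame (j m : ix) (p : pt) : R :=
  let e2 := mkpt 0 0 (partial i3 flat3 p / jac p) (- partial i2 flat3 p / jac p) j in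
  let e3 := mkpt 0 0 (- partial i3 flat2 p / jac p) (partial i2 flat2 p / jac p) j in
  match m with
  | i0 => delta j i0
  | i1 => delta j i1 - flat3 p * p i0 * e2 + flat2 p * p i0 * e3
  | i2 => e2
  | i3 => e3
  end.

(** The last two weights are [1 / phi], written so that the identities below are
    polynomial. *)
Definition weight (m : ix) (p : pt) : R :=
  match m with i0 | i1 => phi_chart p | i2 | i3 => inv_phi_sq p * phi_chart p end.

Lemma jac_pos p : 0 < jac p.
Proof.
  assert (S := sqrt_lt_R0 _ hc1).
  assert (A := stretch_ge p); assert (B := stretch_radial_ge p).
  unfold jac; rewrite !partial_flat2, !partial_flat3; unfold delta; simpl.
  match goal with |- 0 < ?e => replace e with
    (stretch p * (stretch p + (p i2 ^ 2 + p i3 ^ 2) * stretch_der p)) by ring end.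
  apply Rmult_lt_0_compat; lra.
Qed.

Lemma jac_smooth : smooth jac.
Proof.
  apply smooth_minus; apply smooth_mult; apply smooth_partial;
    (exact flat2_smooth || exact flat3_smooth).
Qed.

Lemma coframe_smooth m j : smooth (coframe m j).
Proof.
  assert (Ha := flat2_smooth); assert (Hb := flat3_smooth).
  destruct m; [exact (smooth_const (delta j i0)) | exact (smooth_const (delta j i1)) | |].
  - apply (smooth_plus (partial j flat2) (fun p => flat3 p * p i0 * delta j i1));
      [apply smooth_partial, Ha |].
    apply smooth_mult; [apply smooth_mult |]; auto using smooth_coord, smooth_const.
  - apply (smooth_minus (partial j flat3) (fun p => flat2 p * p i0 * delta j i1));
      [apply smooth_partial, Hb |].
    apply smooth_mult; [apply smooth_mult |]; auto using smooth_coord, smooth_const.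
Qed.

Lemma frame_smooth j m : smooth (frame j m).
Proof.
  assert (Ha := flat2_smooth); assert (Hb := flat3_smooth).
  assert (Q : forall F, smooth F -> smooth (fun p => F p / jac p)).
  { intros F HF; apply smooth_mult; [exact HF |].
    apply smooth_inv; [intros p; apply Rgt_not_eq, jac_pos | exact jac_smooth]. }
  assert (E2 : smooth (fun p => mkpt 0 0 (partial i3 flat3 p / jac p) (- partial i2 flat3 p / jac p) j)).
  { destruct j; simpl; try apply smooth_const.
    - apply Q, smooth_partial, Hb.
    - apply (Q (fun p => - partial i2 flat3 p)), smooth_opp, smooth_partial, Hb. }
  assert (E3 : smooth (fun p => mkpt 0 0 (- partial i3 flat2 p / jac p) (partial i2 flat2 p / jac p) j)).
  { destruct j; simpl; try apply smooth_const.
    - apply (Q (fun p => - partial i3 flat2 p)), smooth_opp, smooth_partial, Ha.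
    - apply Q, smooth_partial, Ha. }
  destruct m; [exact (smooth_const (delta j i0)) | | exact E2 | exact E3].
  unfold frame; apply smooth_plus; [apply smooth_minus; [apply smooth_const |] |];
    apply smooth_mult; auto; apply smooth_mult; auto using smooth_coord.
Qed.

Lemma weight_smooth m : smooth (weight m).
Proof.
  destruct m; try exact phi_chart_smooth; exact (smooth_mult _ _ inv_phi_sq_smooth phi_chart_smooth).
Qed.

Lemma weight_pos m p : 0 < weight m p.
Proof.
  assert (W : 0 < inv_phi_sq p) by (apply Rinv_0_lt_compat, phi_sq_pos).
  assert (P := phi_chart_pos p).
  destruct m; simpl; try exact P; apply Rmult_lt_0_compat; assumption.
Qed.

Lemma partial_flat p :
  partial i0 flat2 p = 0 /\ partial i1 flat2 p = 0 /\ partial i0 flat3 p = 0 /\ partial i1 flat3 p = 0.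
Proof. rewrite !partial_flat2, !partial_flat3; unfold delta; simpl; repeat split; ring. Qed.

Lemma coframe_frame m n p : sum4 (fun j => coframe m j p * frame j n p) = delta m n.
Proof.
  destruct (partial_flat p) as (A0 & A1 & B0 & B1).
  assert (J := jac_pos p); unfold jac in J.
  destruct m, n; unfold sum4, coframe, frame, jac, delta; simpl;
    rewrite ?A0, ?A1, ?B0, ?B1; field; lra.
Qed.

Lemma frame_coframe i j p : sum4 (fun m => frame i m p * coframe m j p) = delta i j.
Proof.
  destruct (partial_flat p) as (A0 & A1 & B0 & B1).
  assert (J := jac_pos p); unfold jac in J.
  destruct i, j; unfold sum4, coframe, frame, jac, delta; simpl;
    rewrite ?A0, ?A1, ?B0, ?B1; field; lra.
Qed.

Definition Jframe (m n : ix) : R :=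
  match m, n with
  | i1, i0 => 1
  | i0, i1 => -1
  | i3, i2 => -1
  | i2, i3 => 1
  | _, _ => 0
  end.

Lemma Jframe_square m n : sum4 (fun k => Jframe m k * Jframe k n) = - delta m n.
Proof. destruct m, n; unfold sum4, delta; simpl; ring. Qed.

Lemma Jframe_weight m n p :
  sum4 (fun k => weight k p * Jframe k m * Jframe k n) = delta m n * weight m p.
Proof. destruct m, n; unfold sum4, delta; simpl; ring. Qed.

(** The connection forms, found from Koszul's formula for the weights [phi, phi,
    1/phi, 1/phi] and the brackets of the frame. They are linear in
    [x, a, b, a/phi^2, b/phi^2], which stand for the arguments [X A B A' B'];
    linearity makes the same table serve for their derivatives. *)
Definition conn_lin (X A B A' B' : R) (m n k : ix) : R :=
  match m, n, k with
  | i0, i0, i2 => / 2 * A'    | i0, i0, i3 => / 2 * B'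
  | i0, i1, i2 => - / 2 * B'  | i0, i1, i3 => / 2 * A'
  | i0, i2, i0 => / 2 * A'    | i0, i2, i1 => - / 2 * B'
  | i0, i3, i0 => / 2 * B'    | i0, i3, i1 => / 2 * A'
  | i1, i0, i2 => / 2 * B'    | i1, i0, i3 => - / 2 * A'
  | i1, i1, i2 => / 2 * A'    | i1, i1, i3 => / 2 * B'
  | i1, i2, i0 => / 2 * B'    | i1, i2, i1 => / 2 * A'
  | i1, i3, i0 => - / 2 * A'  | i1, i3, i1 => / 2 * B'
  | i2, i0, i0 => - / 2 * A   | i2, i0, i1 => / 2 * B
  | i2, i1, i0 => - / 2 * B   | i2, i1, i1 => - / 2 * A
  | i2, i2, i2 => - / 2 * A'  | i2, i2, i3 => - / 2 * B'
  | i2, i3, i1 => 1 * X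
  | i2, i3, i2 => - / 2 * B'  | i2, i3, i3 => / 2 * A'
  | i3, i0, i0 => - / 2 * B   | i3, i0, i1 => - / 2 * A
  | i3, i1, i0 => / 2 * A     | i3, i1, i1 => - / 2 * B
  | i3, i2, i1 => - 1 * X
  | i3, i2, i2 => / 2 * B'    | i3, i2, i3 => - / 2 * A'
  | i3, i3, i2 => - / 2 * A'  | i3, i3, i3 => - / 2 * B'
  | _, _, _ => 0 * X
  end.

Definition conn_coef (m n k : ix) (p : pt) : R :=
  conn_lin (p i0) (flat2 p) (flat3 p) (flat2 p * inv_phi_sq p) (flat3 p * inv_phi_sq p) m n k.

(** The derivatives of [x], [a] and [b] along the frame vectors. *)
Definition frame_d (l : ix) (p : pt) : R * R * R :=
  match l with
  | i0 => (1, 0, 0)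
  | i1 => (0, - (flat3 p * p i0), flat2 p * p i0)
  | i2 => (0, 1, 0)
  | i3 => (0, 0, 1)
  end.

Definition conn_dcoef (m n k l : ix) (p : pt) : R :=
  let '(dx, da, db) := frame_d l p in
  let dw := -2 * inv_phi_sq p ^ 2 * (flat2 p * da + flat3 p * db) in
  conn_lin dx da db (da * inv_phi_sq p + flat2 p * dw) (db * inv_phi_sq p + flat3 p * dw) m n k.

Lemma conn_coef_smooth m n k : smooth (conn_coef m n k).
Proof.
  assert (Ha := flat2_smooth); assert (Hb := flat3_smooth); assert (Hw := inv_phi_sq_smooth).
  assert (Hx := smooth_coord i0).
  assert (Haw : smooth (fun p => flat2 p * inv_phi_sq p)) by (apply smooth_mult; assumption).
  assert (Hbw : smooth (fun p => flat3 p * inv_phi_sq p)) by (apply smooth_mult; assumption).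
  destruct m, n, k; (apply smooth_mult; [apply smooth_const | assumption]).
Qed.

Lemma partial_conn_coef i m n k p :
  partial i (conn_coef m n k) p = sum4 (fun l => conn_dcoef m n k l p * coframe l i p).
Proof.
  assert (Ha := flat2_smooth); assert (Hb := flat3_smooth); assert (Hw := inv_phi_sq_smooth).
  assert (Hx := smooth_coord i0).
  assert (Haw : smooth (fun p => flat2 p * inv_phi_sq p)) by (apply smooth_mult; assumption).
  assert (Hbw : smooth (fun p => flat3 p * inv_phi_sq p)) by (apply smooth_mult; assumption).
  transitivity (conn_lin (partial i (fun q => q i0) p) (partial i flat2 p) (partial i flat3 p)
    (partial i (fun p => flat2 p * inv_phi_sq p) p) (partial i (fun p => flat3 p * inv_phi_sq p) p) m n k).
  { destruct m, n, k; apply partial_scal; assumption. }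
  rewrite !partial_mult_s, partial_inv_phi_sq, partial_coord by assumption.
  destruct m, n, k; unfold conn_dcoef, sum4, coframe; simpl; ring.
Qed.

Lemma coframe_torsion i j m p :
  partial i (coframe m j) p - partial j (coframe m i) p
  = sum4 (fun b => sum4 (fun c =>
      (conn_coef m b c p - conn_coef m c b p) * coframe b i p * coframe c j p)).
Proof.
  assert (Ha := flat2_smooth); assert (Hb := flat3_smooth); assert (Hx := smooth_coord i0).
  assert (E2 : forall i j, partial i (coframe i2 j) p = partial i (partial j flat2) p
    + (partial i flat3 p * p i0 + flat3 p * delta i i0) * delta j i1).
  { intros k l; unfold coframe.
    rewrite (partial_plus_s k (partial l flat2) (fun q => flat3 q * q i0 * delta l i1)),
      (partial_mult_s k (fun q => flat3 q * q i0) (fun _ => delta l i1)), partial_mult_s,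
      partial_coord, partial_const;
      auto using smooth_mult, smooth_const, smooth_partial; ring. }
  assert (E3 : forall i j, partial i (coframe i3 j) p = partial i (partial j flat3) p
    - (partial i flat2 p * p i0 + flat2 p * delta i i0) * delta j i1).
  { intros k l; unfold coframe, Rminus.
    rewrite (partial_plus_s k (partial l flat3) (fun q => - (flat2 q * q i0 * delta l i1))),
      partial_opp,
      (partial_mult_s k (fun q => flat2 q * q i0) (fun _ => delta l i1)), partial_mult_s,
      partial_coord, partial_const;
      auto using smooth_mult, smooth_const, smooth_partial, smooth_opp; ring. }
  destruct m.
  - change (coframe i0 j) with (fun _ : pt => delta j i0).
    change (coframe i0 i) with (fun _ : pt => delta i i0).
    rewrite !partial_const; unfold sum4, conn_coef; simpl; ring.
  - change (coframe i1 j) with (fun _ : pt => delta j i1).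
    change (coframe i1 i) with (fun _ : pt => delta i i1).
    rewrite !partial_const; unfold sum4, conn_coef; simpl; ring.
  - rewrite !E2, (partial_comm i j flat2 p Ha).
    unfold sum4, conn_coef, coframe; simpl; field.
  - rewrite !E3, (partial_comm i j flat3 p Hb).
    unfold sum4, conn_coef, coframe; simpl; field.
Qed.

Lemma weight_compat l m n p :
  delta m n * partial l (weight m) p
  = weight m p * conn_form coframe conn_coef l m n p
    + weight n p * conn_form coframe conn_coef l n m p.
Proof.
  assert (D0 : partial l phi_chart p
    = phi_chart p * inv_phi_sq p * (flat2 p * partial l flat2 p + flat3 p * partial l flat3 p)) by apply partial_phi_chart.
  assert (D2 : partial l (fun q => inv_phi_sq q * phi_chart q) p
    = - (inv_phi_sq p * phi_chart p * inv_phi_sq p * (flat2 p * partial l flat2 p + flat3 p * partial l flat3 p))).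
  { rewrite partial_mult_s, partial_inv_phi_sq, partial_phi_chart by (exact inv_phi_sq_smooth || exact phi_chart_smooth).
    ring. }
  change (partial l phi_chart p) with (partial l (weight i0) p) in D0.
  assert (D1 := D0); change (weight i0) with (weight i1) in D1.
  change (fun q => inv_phi_sq q * phi_chart q) with (weight i2) in D2.
  assert (D3 := D2); change (weight i2) with (weight i3) in D3.
  destruct m, n; rewrite ?D0, ?D1, ?D2, ?D3; unfold delta; simpl ix_eq_dec; cbv iota;
    unfold conn_form, sum4, conn_coef, coframe; simpl; field.
Qed.

Lemma Jframe_commute m n k p :
  sum4 (fun q => conn_coef m q k p * Jframe q n) = sum4 (fun q => Jframe m q * conn_coef q n k p).
Proof. destruct m, n, k; unfold sum4, conn_coef; simpl; ring. Qed.

Definition gM : tensor2 := frame_metric coframe weight.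
Definition JM : endo := frame_endo coframe frame Jframe.
Definition GM : connection := frame_conn coframe frame conn_coef.

Lemma gM_riemannian : riemannian gM.
Proof.
  exact (frame_metric_riemannian coframe frame weight coframe_smooth weight_smooth weight_pos
           frame_coframe).
Qed.

Lemma gM_kahler : kahler gM JM.
Proof.
  apply (frame_kahler coframe frame weight) with (C := conn_coef);
    auto using coframe_smooth, frame_smooth, weight_smooth, weight_pos, coframe_frame,
      frame_coframe, Jframe_square, Jframe_weight, conn_coef_smooth, coframe_torsion,
      weight_compat, Jframe_commute.
Qed.

Lemma gM_levi_civita : levi_civita gM GM.
Proof.
  apply frame_levi_civita;
    auto using coframe_smooth, frame_smooth, weight_smooth, weight_pos, coframe_frame,
      frame_coframe, conn_coef_smooth, coframe_torsion, weight_compat.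
Qed.

(** The Ricci tensor in the frame: minus the pull-back of the flat metric of the
    base. *)
Definition horizontal (c n : ix) : R :=
  match c, n with i0, i0 | i1, i1 => -1 | _, _ => 0 end.

Lemma ricci_coef c n p :
  sum4 (fun m => curv_coef conn_coef conn_dcoef m n m c p) = horizontal c n.
Proof.
  assert (N := phi_sq_pos p).
  destruct c, n; unfold curv_coef, sum4, conn_coef, conn_dcoef; simpl;
    unfold inv_phi_sq, phi_sq in *; field; lra.
Qed.

Lemma gM_ricci_form p i j :
  ricci_form GM JM p i j = delta i i1 * delta j i0 - delta i i0 * delta j i1.
Proof.
  unfold GM, JM.
  rewrite (frame_ricci_form coframe frame coframe_smooth frame_smooth coframe_frame
    frame_coframe Jframe conn_coef conn_dcoef conn_coef_smooth partial_conn_coef coframe_torsion).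
  transitivity (sum4 (fun c => sum4 (fun n => horizontal c n
      * (sum4 (fun q => Jframe c q * coframe q i p) * coframe n j p)))).
  { apply sum4_ext; intros c; apply sum4_ext; intros n; rewrite ricci_coef; reflexivity. }
  unfold sum4; simpl; ring.
Qed.

Lemma gM_centrally_flat : centrally_flat gM JM.
Proof.
  split; [exact gM_kahler |].
  exists GM; split; [exact gM_levi_civita |].
  intros p; unfold wedge22; rewrite !gM_ricci_form; unfold delta; simpl; ring.
Qed.
(** * Completeness *)

Lemma Rabs_le_of_sqr x y n : 0 <= n -> x ^ 2 <= n ^ 2 -> y ^ 2 <= n ^ 2 -> Rabs x <= n /\ Rabs y <= n.
Proof.
  intros Hn Hx Hy; split.
  - rewrite <- (Rabs_pos_eq n Hn); apply Rsqr_le_abs_0; unfold Rsqr; lra.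
  - rewrite <- (Rabs_pos_eq n Hn); apply Rsqr_le_abs_0; unfold Rsqr; lra.
Qed.

Definition coframe_on (m : ix) (p : pt) (v : ix -> R) : R := sum4 (fun i => coframe m i p * v i).

Lemma gM_norm_bounds p v :
  let s := sqrt (phi_chart p) in let n := gnorm gM p v in
  0 < s /\ s ^ 2 = phi_chart p /\ 0 <= n /\
  s * Rabs (coframe_on i0 p v) <= n /\ s * Rabs (coframe_on i1 p v) <= n /\
  Rabs (coframe_on i2 p v) <= s * n /\ Rabs (coframe_on i3 p v) <= s * n.
Proof.
  intros s n.
  assert (P := phi_chart_pos p).
  assert (Hs : 0 < s) by (apply sqrt_lt_R0, P).
  assert (Hs2 : s ^ 2 = phi_chart p) by (apply pow2_sqrt; lra).
  assert (Hn : 0 <= n) by apply gnorm_pos.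
  assert (W : 0 < inv_phi_sq p) by (apply Rinv_0_lt_compat, phi_sq_pos).
  assert (Hn2 : n ^ 2 = s ^ 2 * (coframe_on i0 p v ^ 2 + coframe_on i1 p v ^ 2)
                + inv_phi_sq p * s ^ 2 * (coframe_on i2 p v ^ 2 + coframe_on i3 p v ^ 2)).
  { unfold n, gnorm, gM; rewrite frame_metric_square, pow2_sqrt.
    - rewrite Hs2; unfold coframe_on at 1 2 3 4; unfold sum4 at 1; simpl weight; ring.
    - unfold sum4 at 1; simpl weight.
      assert (Sq : forall a b, 0 <= a -> 0 <= a * b ^ 2)
        by (intros; apply Rmult_le_pos; [assumption | apply pow2_ge_0]).
      repeat apply Rplus_le_le_0_compat; apply Sq; nra. }
  assert (Hw : inv_phi_sq p * s ^ 2 * s ^ 2 = 1) by (rewrite Hs2, <- (inv_phi_sq_spec p); ring).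
  assert (A : forall m, 0 <= coframe_on m p v ^ 2) by (intros; apply pow2_ge_0).
  assert (H01 : s ^ 2 * coframe_on i0 p v ^ 2 <= n ^ 2 /\ s ^ 2 * coframe_on i1 p v ^ 2 <= n ^ 2).
  { assert (0 <= inv_phi_sq p * s ^ 2 * (coframe_on i2 p v ^ 2 + coframe_on i3 p v ^ 2)).
    { apply Rmult_le_pos; [nra |]; generalize (A i2) (A i3); lra. }
    generalize (A i0) (A i1); nra. }
  assert (H23 : coframe_on i2 p v ^ 2 <= s ^ 2 * n ^ 2 /\ coframe_on i3 p v ^ 2 <= s ^ 2 * n ^ 2).
  { assert (E : s ^ 2 * n ^ 2 = s ^ 2 * (s ^ 2 * (coframe_on i0 p v ^ 2 + coframe_on i1 p v ^ 2))
       + (coframe_on i2 p v ^ 2 + coframe_on i3 p v ^ 2)).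
    { rewrite Hn2, Rmult_plus_distr_l; f_equal.
      rewrite <- (Rmult_1_l (coframe_on i2 p v ^ 2 + coframe_on i3 p v ^ 2)) at 2; rewrite <- Hw; ring. }
    assert (0 <= s ^ 2 * (s ^ 2 * (coframe_on i0 p v ^ 2 + coframe_on i1 p v ^ 2))).
    { apply Rmult_le_pos; [nra | apply Rmult_le_pos; [nra |]]; generalize (A i0) (A i1); lra. }
    generalize (A i2) (A i3); lra. }
  assert (Hsn : 0 <= s * n) by (apply Rmult_le_pos; lra).
  destruct (Rabs_le_of_sqr (s * coframe_on i0 p v) (s * coframe_on i1 p v) n Hn) as [B0 B1]; [lra | lra |].
  destruct (Rabs_le_of_sqr (coframe_on i2 p v) (coframe_on i3 p v) (s * n) Hsn) as [B2 B3]; [lra | lra |].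
  rewrite Rabs_mult, (Rabs_pos_eq s) in B0, B1 by lra.
  repeat split; auto; lra.
Qed.

(** The first term has gradient at most 1 because [phi >= c1] gives
    [sqrt c1 * |dx| <= ds]; the second because [phi * dphi = a da + b db] (with
    the horizontal parts cancelling) gives [|d sqrt phi| <= ds / 2]. *)
Definition exhaust (p : pt) : R := sqrt c1 * sqrt (1 + p i0 ^ 2) + sqrt (phi_chart p).

Lemma exhaust_smooth : smooth exhaust.
Proof.
  apply smooth_plus; [apply smooth_mult; [apply smooth_const |] |].
  - apply smooth_sqrt; [intros p; nra |].
    apply smooth_plus; [apply smooth_const | apply smooth_sqr, smooth_coord].
  - exact (smooth_sqrt phi_chart phi_chart_pos phi_chart_smooth).
Qed.

Lemma partial_exhaust i p :
  partial i exhaust p = sqrt c1 * (p i0 / sqrt (1 + p i0 ^ 2)) * coframe i0 i p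
    + sqrt (phi_chart p) * inv_phi_sq p / 2 * (flat2 p * coframe i2 i p + flat3 p * coframe i3 i p).
Proof.
  assert (P := phi_chart_pos p).
  assert (Hs := sqrt_lt_R0 _ P).
  assert (Hq : forall q : pt, 0 < 1 + q i0 ^ 2) by (intros q; nra).
  assert (Hr := sqrt_lt_R0 _ (Hq p)).
  assert (Sm : smooth (fun q : pt => 1 + q i0 ^ 2)).
  { apply smooth_plus; [apply smooth_const | apply smooth_sqr, smooth_coord]. }
  assert (Ds : forall F, smooth F -> 0 < F p ->
    partial i (fun q => sqrt (F q)) p = / (2 * sqrt (F p)) * partial i F p).
  { intros F HF HP; apply (partial_comp i sqrt); [apply smooth_has_partial, HF |].
    evar_last; [apply (is_derive_sqrt (fun x => x)); [apply is_derive_id | exact HP] |].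
    unfold one; simpl; field; apply Rgt_not_eq, sqrt_lt_R0, HP. }
  unfold exhaust.
  rewrite (partial_plus_s i (fun q => sqrt c1 * sqrt (1 + q i0 ^ 2)) (fun q => sqrt (phi_chart q))).
  2: apply smooth_mult; [apply smooth_const | exact (smooth_sqrt _ Hq Sm)].
  2: exact (smooth_sqrt phi_chart phi_chart_pos phi_chart_smooth).
  rewrite (partial_scal i (sqrt c1) (fun q => sqrt (1 + q i0 ^ 2))) by exact (smooth_sqrt _ Hq Sm).
  rewrite (Ds (fun q => 1 + q i0 ^ 2)), (Ds phi_chart) by auto using phi_chart_smooth.
  rewrite (partial_plus_s i (fun _ => 1)), partial_const, partial_sqr, partial_coord, partial_phi_chart
    by auto using smooth_const, smooth_sqr, smooth_coord.
  rewrite <- (sqrt_sqrt (phi_chart p)) at 2 by lra.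
  unfold coframe; field; lra.
Qed.

Lemma exhaust_lipschitz p v :
  Rabs (sum4 (fun i => partial i exhaust p * v i)) <= 2 * gnorm gM p v.
Proof.
  destruct (gM_norm_bounds p v) as (Hs & Hs2 & Hn & B0 & _ & B2 & B3).
  set (s := sqrt (phi_chart p)) in *; set (n := gnorm gM p v) in *.
  assert (Hr : Rabs (p i0 / sqrt (1 + p i0 ^ 2)) <= 1).
  { assert (Hr := sqrt_lt_R0 (1 + p i0 ^ 2) ltac:(nra)).
    unfold Rdiv; rewrite Rabs_mult, Rabs_inv, (Rabs_pos_eq (sqrt _)) by lra.
    apply (Rmult_le_reg_r (sqrt (1 + p i0 ^ 2))); [exact Hr |].
    rewrite Rmult_assoc, Rinv_l, Rmult_1_r, Rmult_1_l by lra.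
    rewrite <- sqrt_Rsqr_abs; apply sqrt_le_1_alt; unfold Rsqr; nra. }
  assert (Hc : sqrt c1 <= s).
  { apply sqrt_le_1_alt; unfold phi_chart, phi_sq.
    rewrite <- (sqrt_pow2 c1) at 1 by lra; apply sqrt_le_1_alt; nra. }
  assert (Hc0 := sqrt_lt_R0 _ hc1).
  assert (Hab : Rabs (flat2 p) <= s ^ 2 /\ Rabs (flat3 p) <= s ^ 2).
  { apply Rabs_le_of_sqr; [nra | |]; rewrite Hs2, phi_chart_sq; unfold phi_sq; nra. }
  assert (Hw : inv_phi_sq p * s ^ 2 * s ^ 2 = 1) by (rewrite Hs2, <- (inv_phi_sq_spec p); ring).
  assert (W : 0 < inv_phi_sq p) by (apply Rinv_0_lt_compat, phi_sq_pos).
  replace (sum4 (fun i => partial i exhaust p * v i))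
    with (sqrt c1 * (p i0 / sqrt (1 + p i0 ^ 2)) * coframe_on i0 p v
          + s * inv_phi_sq p / 2 * (flat2 p * coframe_on i2 p v + flat3 p * coframe_on i3 p v)).
  2: { transitivity (sum4 (fun i => (sqrt c1 * (p i0 / sqrt (1 + p i0 ^ 2)) * coframe i0 i p
         + s * inv_phi_sq p / 2 * (flat2 p * coframe i2 i p + flat3 p * coframe i3 i p)) * v i)).
       - unfold coframe_on, sum4; ring.
       - apply sum4_ext; intros i; rewrite partial_exhaust; reflexivity. }
  assert (T1 : Rabs (sqrt c1 * (p i0 / sqrt (1 + p i0 ^ 2)) * coframe_on i0 p v) <= n).
  { rewrite !Rabs_mult, (Rabs_pos_eq (sqrt c1)) by lra.
    eapply Rle_trans; [| exact B0].
    apply Rmult_le_compat_r; [apply Rabs_pos |].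
    generalize (Rabs_pos (p i0 / sqrt (1 + p i0 ^ 2))); nra. }
  assert (T2 : Rabs (flat2 p * coframe_on i2 p v + flat3 p * coframe_on i3 p v) <= 2 * (s ^ 2 * (s * n))).
  { eapply Rle_trans; [apply Rabs_triang |]; rewrite !Rabs_mult.
    assert (Rabs (flat2 p) * Rabs (coframe_on i2 p v) <= s ^ 2 * (s * n))
      by (apply Rmult_le_compat; try apply Rabs_pos; tauto).
    assert (Rabs (flat3 p) * Rabs (coframe_on i3 p v) <= s ^ 2 * (s * n))
      by (apply Rmult_le_compat; try apply Rabs_pos; tauto).
    lra. }
  assert (T3 : Rabs (s * inv_phi_sq p / 2 * (flat2 p * coframe_on i2 p v + flat3 p * coframe_on i3 p v)) <= n).
  { rewrite Rabs_mult, (Rabs_pos_eq (s * inv_phi_sq p / 2)) by nra.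
    apply Rle_trans with (s * inv_phi_sq p / 2 * (2 * (s ^ 2 * (s * n)))).
    - apply Rmult_le_compat_l; [nra | exact T2].
    - right; transitivity (inv_phi_sq p * s ^ 2 * s ^ 2 * n); [field | rewrite Hw; ring]. }
  eapply Rle_trans; [apply Rabs_triang | lra].
Qed.

(** The differential of [(u, v) |-> (a, b)] has the eigenvalues [h r / r]
    (tangential) and [h' r] (radial), both at least [sqrt c1]. *)
Lemma flat_expansion p (y z : R) :
  let da := partial i2 flat2 p * y + partial i3 flat2 p * z in
  let db := partial i2 flat3 p * y + partial i3 flat3 p * z in
  c1 * (y ^ 2 + z ^ 2) <= da ^ 2 + db ^ 2.
Proof.
  intros da db.
  assert (A := stretch_ge p); assert (B := stretch_radial_ge p).
  assert (S := sqrt_sqrt c1 ltac:(lra)).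
  assert (Hc0 := sqrt_lt_R0 _ hc1).
  set (k := stretch p) in *; set (e := stretch_der p) in *.
  set (u := p i2) in *; set (w := p i3) in *.
  assert (Ea : da = k * y + e * u * (u * y + w * z)).
  { unfold da; rewrite !partial_flat2; unfold delta; simpl; fold k e u w; ring. }
  assert (Eb : db = k * z + e * w * (u * y + w * z)).
  { unfold db; rewrite !partial_flat3; unfold delta; simpl; fold k e u w; ring. }
  rewrite Ea, Eb.
  set (m := u ^ 2 + w ^ 2) in *.
  set (d := u * y + w * z).
  assert (Hk : c1 <= k ^ 2) by nra.
  assert (He : c1 <= (k + m * e) ^ 2) by nra.
  assert (Hm : 0 <= m) by (unfold m; nra).
  destruct (Rle_lt_or_eq_dec 0 m Hm) as [L | Z].
  - apply (Rmult_le_reg_l m); [exact L |].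
    replace (m * ((k * y + e * u * d) ^ 2 + (k * z + e * w * d) ^ 2))
      with ((k + m * e) ^ 2 * d ^ 2 + k ^ 2 * (u * z - w * y) ^ 2)
      by (unfold d, m; ring).
    replace (m * (c1 * (y ^ 2 + z ^ 2)))
      with (c1 * d ^ 2 + c1 * (u * z - w * y) ^ 2) by (unfold d, m; ring).
    apply Rplus_le_compat; apply Rmult_le_compat_r; (apply pow2_ge_0 || assumption).
  - assert (Zu : u = 0) by (unfold m in Z; nra); assert (Zw : w = 0) by (unfold m in Z; nra).
    replace ((k * y + e * u * d) ^ 2 + (k * z + e * w * d) ^ 2)
      with (k ^ 2 * (y ^ 2 + z ^ 2)) by (rewrite Zu, Zw; ring).
    apply Rmult_le_compat_r; [nra | exact Hk].
Qed.

(** On [exhaust <= B] both [phi] and [x] are bounded, hence so is the change from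
    the orthogonal coframe to [dx, dy, da, db]; the change to [du, dv] is
    controlled by [flat_expansion]. *)
Lemma gM_locally_euclidean B :
  exists C, forall p v i, exhaust p <= B -> Rabs (v i) <= C * gnorm gM p v.
Proof.
  set (k := sqrt c1).
  assert (Hk : 0 < k) by (apply sqrt_lt_R0, hc1).
  assert (Hk2 : k * k = c1) by (apply sqrt_sqrt; lra).
  (* [/ k] serves for the first two coordinates; [B + B * B / k] bounds [da] and
     [db], its two terms coming from the orthogonal coframe and from [x dy]. *)
  exists (/ k + 2 * (B + B * B / k) / k); intros p v i HB.
  destruct (gM_norm_bounds p v) as (Hs & Hs2 & Hn & B0 & B1 & B2 & B3).
  assert (HsB : sqrt (phi_chart p) <= B /\ k * Rabs (p i0) <= B).
  { unfold exhaust in HB; fold k in HB.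
    assert (Rabs (p i0) <= sqrt (1 + p i0 ^ 2)).
    { rewrite <- sqrt_Rsqr_abs; apply sqrt_le_1_alt; unfold Rsqr; nra. }
    generalize (Rabs_pos (p i0)); nra. }
  assert (Hc : k <= sqrt (phi_chart p)).
  { apply sqrt_le_1_alt; unfold phi_chart, phi_sq.
    rewrite <- (sqrt_pow2 c1) at 1 by lra; apply sqrt_le_1_alt; nra. }
  assert (Hab : Rabs (flat2 p) <= sqrt (phi_chart p) ^ 2 /\ Rabs (flat3 p) <= sqrt (phi_chart p) ^ 2).
  { apply Rabs_le_of_sqr; [nra | |]; rewrite Hs2, phi_chart_sq; unfold phi_sq; nra. }
  set (s := sqrt (phi_chart p)) in *; set (n := gnorm gM p v) in *.
  destruct HsB as [HsB HxB]; destruct Hab as [Ha Hb].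
  assert (E0 : coframe_on i0 p v = v i0) by (unfold coframe_on, sum4, coframe, delta; simpl; ring).
  assert (E1 : coframe_on i1 p v = v i1) by (unfold coframe_on, sum4, coframe, delta; simpl; ring).
  rewrite E0 in B0; rewrite E1 in B1.
  assert (HB0 : 0 < B) by lra.
  assert (Inv : forall t, s * Rabs t <= n -> Rabs t <= / k * n).
  { intros t Ht; apply (Rmult_le_reg_l k); [exact Hk |].
    rewrite <- Rmult_assoc, Rinv_r, Rmult_1_l by lra.
    generalize (Rabs_pos t); nra. }
  assert (P1 : 0 <= 2 * (B + B * B / k) / k * n).
  { apply Rmult_le_pos; [| exact Hn].
    assert (0 < / k) by (apply Rinv_0_lt_compat, Hk).
    unfold Rdiv; apply Rmult_le_pos; [| lra].
    apply Rmult_le_pos; [lra |].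
    assert (0 < B * B * / k) by (apply Rmult_lt_0_compat; nra); lra. }
  assert (P2 : 0 <= / k * n).
  { apply Rmult_le_pos; [left; apply Rinv_0_lt_compat, Hk | exact Hn]. }
  set (da := partial i2 flat2 p * v i2 + partial i3 flat2 p * v i3).
  set (db := partial i2 flat3 p * v i2 + partial i3 flat3 p * v i3).
  destruct (partial_flat p) as (A0 & A1 & A2 & A3).
  assert (E2 : da = coframe_on i2 p v - flat3 p * p i0 * v i1).
  { unfold da, coframe_on, sum4, coframe, delta; simpl; rewrite A0, A1; ring. }
  assert (E3 : db = coframe_on i3 p v + flat2 p * p i0 * v i1).
  { unfold db, coframe_on, sum4, coframe, delta; simpl; rewrite A2, A3; ring. }
  assert (Hxv : forall f, Rabs f <= s ^ 2 -> Rabs (f * p i0 * v i1) <= B * B / k * n).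
  { intros f Hf; rewrite !Rabs_mult.
    assert (X : Rabs (p i0) <= B / k).
    { apply (Rmult_le_reg_l k); [exact Hk |].
      replace (k * (B / k)) with B by (field; lra); exact HxB. }
    assert (Y : Rabs f * Rabs (v i1) <= B * n).
    { apply Rle_trans with (s * (s * Rabs (v i1))).
      - generalize (Rabs_pos (v i1)); nra.
      - apply Rmult_le_compat; try lra.
        apply Rmult_le_pos; [lra | apply Rabs_pos]. }
    replace (Rabs f * Rabs (p i0) * Rabs (v i1)) with ((Rabs f * Rabs (v i1)) * Rabs (p i0)) by ring.
    replace (B * B / k * n) with (B * n * (B / k)) by (field; lra).
    apply Rmult_le_compat; try apply Rabs_pos; auto.
    apply Rmult_le_pos; apply Rabs_pos. }
  set (D := (B + B * B / k) * n).
  assert (Hda : Rabs da <= D).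
  { rewrite E2; unfold Rminus; eapply Rle_trans; [apply Rabs_triang |].
    rewrite Rabs_Ropp; specialize (Hxv _ Hb); unfold D; nra. }
  assert (Hdb : Rabs db <= D).
  { rewrite E3; eapply Rle_trans; [apply Rabs_triang |].
    specialize (Hxv _ Ha); unfold D; nra. }
  assert (HD : 0 <= D) by (eapply Rle_trans; [apply Rabs_pos | exact Hda]).
  assert (Hexp := flat_expansion p (v i2) (v i3)); cbv zeta in Hexp; fold da db in Hexp.
  assert (Hda2 : da ^ 2 <= D ^ 2) by (apply pow_maj_Rabs; exact Hda).
  assert (Hdb2 : db ^ 2 <= D ^ 2) by (apply pow_maj_Rabs; exact Hdb).
  destruct (Rabs_le_of_sqr (k * v i2) (k * v i3) (2 * D)) as [C2 C3]; [lra | nra | nra |].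
  rewrite Rabs_mult, (Rabs_pos_eq k) in C2, C3 by lra.
  assert (Fin : forall t, k * Rabs t <= 2 * D -> Rabs t <= 2 * (B + B * B / k) / k * n).
  { intros t Ht; apply (Rmult_le_reg_l k); [exact Hk |].
    replace (k * (2 * (B + B * B / k) / k * n)) with (2 * D) by (unfold D; field; lra); exact Ht. }
  rewrite Rmult_plus_distr_r.
  destruct i.
  - specialize (Inv _ B0); lra.
  - specialize (Inv _ B1); lra.
  - specialize (Fin _ C2); lra.
  - specialize (Fin _ C3); lra.
Qed.

Lemma gM_complete : complete gM.
Proof.
  apply (complete_of_exhaustion gM exhaust 2).
  - exact gM_riemannian.
  - exact exhaust_smooth.
  - lra.
  - exact exhaust_lipschitz.
  - exact gM_locally_euclidean.
Qed.

(** * The regular part *)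

(** Substitution [t = e^s] in the arc length, as [e^s / warp (e^s)] is the
    derivative of [arc (e^s)], which tends to [arc 0 = 0] at minus infinity. *)
Lemma radius_arc q : radius c1 q = arc c1 (exp q).
Proof.
  assert (D : forall s, is_derive (fun s => arc c1 (exp s)) s (exp s * / warp c1 (exp s))).
  { intros s; apply (is_derive_comp (arc c1) exp); [apply is_derive_arc, hc1 |].
    apply is_derive_Reals, derivable_pt_lim_exp. }
  assert (E : forall s, sqrt (metric c1 (mkpt s 0 0 0) i0 i0) = exp s * / warp c1 (exp s)).
  { intros s; unfold metric, dq, sigma1, sigma2, sigma3, warp; simpl.
    assert (X := exp_pos s).
    replace (2 * s) with (s + s) by ring; rewrite exp_plus.
    replace (c1 * (c1 * 1)) with (c1 ^ 2) by ring.
    replace (exp s * (exp s * 1)) with (exp s * exp s) by ring.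
    set (y := sqrt (exp s * exp s + c1 ^ 2)).
    assert (Y : 0 < y) by (apply sqrt_lt_R0; nra).
    assert (Q := sqrt_lt_R0 y Y); assert (Q2 := sqrt_sqrt y ltac:(lra)).
    rewrite <- (sqrt_pow2 (exp s * / sqrt y)).
    - f_equal; rewrite <- Q2 at 1 2; field; lra.
    - apply Rmult_le_pos; [lra | left; apply Rinv_0_lt_compat, Q]. }
  assert (C : forall s, continuous (fun s => exp s * / warp c1 (exp s)) s).
  { intros s; apply (ex_derive_continuous (fun s => exp s * / warp c1 (exp s))).
    apply ex_derive_mult; [eexists; apply is_derive_Reals, derivable_pt_lim_exp |].
    apply (ex_derive_comp (fun t => / warp c1 t) exp).
    - eexists; apply is_derive_inv; [apply is_derive_warp, hc1 | apply Rgt_not_eq, warp_pos, hc1].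
    - eexists; apply is_derive_Reals, derivable_pt_lim_exp. }
  unfold radius.
  replace (fun s => sqrt (metric c1 (mkpt s 0 0 0) i0 i0))
    with (Derive (fun s => arc c1 (exp s))).
  2: { apply functional_extensionality; intros s; rewrite E; apply is_derive_unique, D. }
  replace (arc c1 (exp q)) with (arc c1 (exp q) - 0) by ring.
  apply (is_RInt_gen_unique (V := R_CompleteNormedModule)
    (Fa := Rbar_locally m_infty) (Fb := at_point q)).
  apply (is_RInt_gen_Derive (Fa := Rbar_locally m_infty) (Fb := at_point q)
           (fun s => arc c1 (exp s)) 0 (arc c1 (exp q))).
  - exists (fun _ => True) (fun _ => True); [exists 0; auto | exact I |].
    intros a b _ _ x _; eexists; apply D.
  - exists (fun _ => True) (fun _ => True); [exists 0; auto | exact I |].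
    intros a b _ _ x _.
    apply (continuous_ext (fun s => exp s * / warp c1 (exp s))); [| apply C].
    intros s; symmetry; apply is_derive_unique, D.
  - apply (filterlim_comp _ _ _ exp (arc c1) _ (locally 0)).
    + apply is_lim_exp_m.
    + replace (locally 0) with (locally (arc c1 0)) at 2 by (rewrite arc_0; reflexivity).
      apply (ex_derive_continuous (arc c1)); eexists; apply is_derive_arc, hc1.
  - intros P HP; exact (locally_singleton _ _ HP).
Qed.

Lemma is_derive_radius (q : R) : is_derive (radius c1) q (exp q * / warp c1 (exp q)).
Proof.
  apply is_derive_ext with (fun s => arc c1 (exp s)); [intros s; symmetry; apply radius_arc |].
  apply (is_derive_comp (arc c1) exp); [apply is_derive_arc, hc1 |].
  apply is_derive_Reals, derivable_pt_lim_exp.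
Qed.

Lemma radius_pos q : 0 < radius c1 q.
Proof. rewrite radius_arc, <- (arc_0 c1); apply arc_inc; [exact hc1 | apply exp_pos]. Qed.

Lemma has_partial_regular i k p : has_partial i (fun x => regular_part c1 x k) p.
Proof.
  assert (Hcoord : forall j, has_partial i (fun x => x j) p)
    by (intros j; apply smooth_has_partial, smooth_coord).
  assert (Hr : has_partial i (fun x => radius c1 (x i0)) p).
  { apply (partial_comp i (radius c1) (fun x => x i0) p _ (Hcoord i0) (is_derive_radius _)). }
  assert (Hc : has_partial i (fun x => cos (x i3)) p).
  { apply (partial_comp i cos (fun x => x i3) p (- sin (p i3)) (Hcoord i3)).
    apply is_derive_Reals, derivable_pt_lim_cos. }
  assert (Hs : has_partial i (fun x => sin (x i3)) p).
  { apply (partial_comp i sin (fun x => x i3) p (cos (p i3)) (Hcoord i3)).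
    apply is_derive_Reals, derivable_pt_lim_sin. }
  destruct k; [apply Hcoord | apply Hcoord | |].
  - unfold has_partial; apply (ex_derive_ext (fun t => (fun x : pt => cos (x i3) * radius c1 (x i0)) (upd p i t))).
    + intros t; unfold regular_part, M_chart, rot; simpl; Rring.
    + apply (has_partial_mult i (fun x => cos (x i3)) (fun x => radius c1 (x i0))); assumption.
  - unfold has_partial; apply (ex_derive_ext (fun t => (fun x : pt => sin (x i3) * radius c1 (x i0)) (upd p i t))).
    + intros t; unfold regular_part, M_chart, rot; simpl; Rring.
    + apply (has_partial_mult i (fun x => sin (x i3)) (fun x => radius c1 (x i0))); assumption.
Qed.

Lemma partial_pull F i p :
  smooth F ->
  partial i (fun x => F (regular_part c1 x)) p
  = sum4 (fun k => partial k F (regular_part c1 p)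
                   * partial i (fun x => regular_part c1 x k) p).
Proof.
  intros HF; apply is_derive_unique.
  evar_last.
  - apply (is_derive_curve F (fun t => regular_part c1 (upd p i t)) (p i)
             (fun k => partial i (fun x => regular_part c1 x k) p)); [apply HF |].
    intros k; apply Derive_correct, has_partial_regular.
  - cbv beta; rewrite upd_same; reflexivity.
Qed.

Lemma flat_regular p :
  flat2 (regular_part c1 p) = exp (p i0) * cos (p i3) /\
  flat3 (regular_part c1 p) = exp (p i0) * sin (p i3).
Proof.
  assert (Hr := radius_pos (p i0)).
  assert (E : radius c1 (p i0) * stretch (regular_part c1 p) = exp (p i0)).
  { unfold stretch, radial.
    replace (sqrt _) with (radius c1 (p i0)).
    - rewrite (slope_spec h _ h_smooth), (profile_0 c1 h h_arc), radius_arc, h_arc; ring.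
    - rewrite <- (sqrt_pow2 (radius c1 (p i0))) at 1 by lra; f_equal.
      unfold regular_part, M_chart, rot; simpl.
      generalize (sin2_cos2 (p i3)); unfold Rsqr; intros Z.
      transitivity (radius c1 (p i0) * radius c1 (p i0)
        * (sin (p i3) * sin (p i3) + cos (p i3) * cos (p i3))); [rewrite Z |]; ring. }
  unfold flat2, flat3; rewrite <- E.
  change (regular_part c1 p i2) with (cos (p i3) * radius c1 (p i0) - sin (p i3) * 0).
  change (regular_part c1 p i3) with (sin (p i3) * radius c1 (p i0) + cos (p i3) * 0).
  split; ring.
Qed.

(** The pulled-back coframe in the coordinates [(q, x, y, z)]: the last two elements
    are the combinations [e^q (cos z dq + sin z sigma3)] and
    [e^q (sin z dq - cos z sigma3)]. *)
Definition pull_coframe (m i : ix) (p : pt) : R :=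
  let e := exp (p i0) in let c := cos (p i3) in let s := sin (p i3) in
  match m with
  | i0 => delta i i1
  | i1 => delta i i2
  | i2 => e * c * delta i i0 - e * s * delta i i3 + e * s * p i1 * delta i i2
  | i3 => e * s * delta i i0 + e * c * delta i i3 - e * c * p i1 * delta i i2
  end.

Lemma coframe_pullback m i p :
  sum4 (fun k => coframe m k (regular_part c1 p)
                 * partial i (fun x => regular_part c1 x k) p)
  = pull_coframe m i p.
Proof.
  assert (X0 : partial i (fun x => regular_part c1 x i0) p = delta i i1)
    by exact (partial_coord i i1 p).
  assert (X1 : partial i (fun x => regular_part c1 x i1) p = delta i i2)
    by exact (partial_coord i i2 p).
  assert (Hcoord : forall j, has_partial i (fun x => x j) p)
    by (intros j; apply smooth_has_partial, smooth_coord).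
  assert (De : forall f f', (forall y, is_derive f y (f' y)) ->
    has_partial i (fun x => exp (x i0) * f (x i3)) p /\
    partial i (fun x => exp (x i0) * f (x i3)) p
    = exp (p i0) * delta i i0 * f (p i3) + exp (p i0) * (f' (p i3) * delta i i3)).
  { intros f f' Hf.
    destruct (partial_comp i exp (fun x => x i0) p (exp (p i0)) (Hcoord i0)) as [H1 E1];
      [apply is_derive_Reals, derivable_pt_lim_exp |].
    destruct (partial_comp i f (fun x => x i3) p (f' (p i3)) (Hcoord i3) (Hf _)) as [H2 E2].
    split; [apply (has_partial_mult i (fun x => exp (x i0))); assumption |].
    rewrite (partial_mult i (fun x => exp (x i0)) (fun x => f (x i3))), E1, E2, !partial_coord
      by assumption; reflexivity. }
  destruct (De cos (fun y => - sin y)) as [_ Dc].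
  { intros y; apply is_derive_Reals, derivable_pt_lim_cos. }
  destruct (De sin cos) as [_ Ds].
  { intros y; apply is_derive_Reals, derivable_pt_lim_sin. }
  destruct (flat_regular p) as [Fa Fb].
  assert (Pa := partial_pull flat2 i p flat2_smooth).
  replace (fun x => flat2 (regular_part c1 x)) with (fun x : pt => exp (x i0) * cos (x i3)) in Pa
    by (apply functional_extensionality; intros x; symmetry; apply flat_regular).
  assert (Pb := partial_pull flat3 i p flat3_smooth).
  replace (fun x => flat3 (regular_part c1 x)) with (fun x : pt => exp (x i0) * sin (x i3)) in Pb
    by (apply functional_extensionality; intros x; symmetry; apply flat_regular).
  rewrite Dc in Pa; rewrite Ds in Pb.
  destruct m; unfold coframe, pull_coframe.
  - rewrite <- X0; unfold sum4, delta; simpl; ring.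
  - rewrite <- X1; unfold sum4, delta; simpl; ring.
  - transitivity (sum4 (fun k => partial k flat2 (regular_part c1 p)
      * partial i (fun x => regular_part c1 x k) p)
      + flat3 (regular_part c1 p) * regular_part c1 p i0
        * partial i (fun x => regular_part c1 x i1) p).
    { unfold sum4, delta; simpl ix_eq_dec; cbv iota; ring. }
    rewrite <- Pa, X1, Fb; change (regular_part c1 p i0) with (p i1); ring.
  - transitivity (sum4 (fun k => partial k flat3 (regular_part c1 p)
      * partial i (fun x => regular_part c1 x k) p)
      - flat2 (regular_part c1 p) * regular_part c1 p i0
        * partial i (fun x => regular_part c1 x i1) p).
    { unfold sum4, delta; simpl ix_eq_dec; cbv iota; ring. }
    rewrite <- Pb, X1, Fa; change (regular_part c1 p i0) with (p i1); ring.
Qed.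

Lemma weight_regular p :
  weight i0 (regular_part c1 p) = phi c1 (p i0) /\
  weight i2 (regular_part c1 p) = / phi c1 (p i0) /\
  phi c1 (p i0) ^ 2 = exp (p i0) ^ 2 + c1 ^ 2 /\ 0 < phi c1 (p i0).
Proof.
  destruct (flat_regular p) as [Fa Fb].
  assert (E2 : exp (2 * p i0) = exp (p i0) ^ 2).
  { replace (2 * p i0) with (p i0 + p i0) by ring; rewrite exp_plus; ring. }
  assert (E : phi_sq (regular_part c1 p) = exp (p i0) ^ 2 + c1 ^ 2).
  { unfold phi_sq; rewrite Fa, Fb.
    generalize (sin2_cos2 (p i3)); unfold Rsqr; intros Z.
    transitivity (exp (p i0) ^ 2
      * (sin (p i3) * sin (p i3) + cos (p i3) * cos (p i3)) + c1 ^ 2); [| rewrite Z]; ring. }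
  assert (Ephi : phi_chart (regular_part c1 p) = phi c1 (p i0)).
  { unfold phi_chart, phi; rewrite E, E2; reflexivity. }
  assert (P := phi_chart_pos (regular_part c1 p)).
  assert (S := phi_chart_sq (regular_part c1 p)).
  assert (W := inv_phi_sq_spec (regular_part c1 p)).
  simpl weight; rewrite Ephi in *; rewrite E in S.
  repeat split; auto.
  apply (Rmult_eq_reg_r (phi c1 (p i0))); [| lra].
  rewrite Rinv_l, <- W by lra; ring.
Qed.

Lemma frame_pullback (b : tensor2) (w : ix -> ix -> pt -> R) p i j :
  (forall q k l, b q k l = sum4 (fun m => sum4 (fun n => w m n q * coframe m k q * coframe n l q))) ->
  pullback (regular_part c1) b p i j
  = sum4 (fun m => sum4 (fun n =>
      w m n (regular_part c1 p) * pull_coframe m i p * pull_coframe n j p)).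
Proof.
  intros Hb; unfold pullback.
  transitivity (sum4 (fun m => sum4 (fun n => w m n (regular_part c1 p)
    * sum4 (fun k => coframe m k (regular_part c1 p) * partial i (fun x => regular_part c1 x k) p)
    * sum4 (fun k => coframe n k (regular_part c1 p) * partial j (fun x => regular_part c1 x k) p)))).
  - transitivity (sum4 (fun k => sum4 (fun l =>
      sum4 (fun m => sum4 (fun n => w m n (regular_part c1 p)
        * coframe m k (regular_part c1 p) * coframe n l (regular_part c1 p)))
      * partial i (fun x => regular_part c1 x k) p * partial j (fun x => regular_part c1 x l) p))).
    { apply sum4_ext; intros k; apply sum4_ext; intros l; rewrite Hb; reflexivity. }
    set (q := regular_part c1 p).
    set (P := fun k => partial i (fun x => regular_part c1 x k) p).
    set (Q := fun k => partial j (fun x => regular_part c1 x k) p).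
    change (sum4 (fun k => sum4 (fun l =>
      sum4 (fun m => sum4 (fun n => w m n q * coframe m k q * coframe n l q)) * P k * Q l))
      = sum4 (fun m => sum4 (fun n => w m n q
          * sum4 (fun k => coframe m k q * P k) * sum4 (fun k => coframe n k q * Q k)))).
    unfold sum4; ring.
  - apply sum4_ext; intros m; apply sum4_ext; intros n; rewrite !coframe_pullback; reflexivity.
Qed.

Lemma gM_extends : extends_to_M c1 (metric c1) gM.
Proof.
  intros p i j.
  rewrite (frame_pullback gM (fun m n q => delta m n * weight m q)).
  2: { intros q k l; unfold gM, frame_metric; apply sum4_ext; intros m.
       rewrite <- (sum4_delta (fun n => weight m q * coframe m k q * coframe n l q) m).
       apply sum4_ext; intros n; ring. }
  destruct (weight_regular p) as (W0 & W2 & Hphi & Ppos).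
  assert (W1 : weight i1 (regular_part c1 p) = phi c1 (p i0)) by exact W0.
  assert (W3 : weight i3 (regular_part c1 p) = / phi c1 (p i0)) by exact W2.
  assert (E2 : exp (2 * p i0) = exp (p i0) * exp (p i0)).
  { replace (2 * p i0) with (p i0 + p i0) by ring; apply exp_plus. }
  assert (Z : sin (p i3) * sin (p i3) = 1 - cos (p i3) * cos (p i3)).
  { generalize (sin2_cos2 (p i3)); unfold Rsqr; lra. }
  unfold metric; fold (phi c1 (p i0)).
  unfold sum4, delta; simpl ix_eq_dec; cbv iota; rewrite W0, W1, W2, W3, E2.
  unfold Rdiv; set (f := / phi c1 (p i0)); clearbody f.
  destruct i, j; unfold pull_coframe, dq, sigma1, sigma2, sigma3, delta; simpl; ring [Z].
Qed.

Lemma partial_phi i p :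
  has_partial i (fun x => phi c1 (x i0)) p /\
  partial i (fun x => phi c1 (x i0)) p
  = exp (p i0) * exp (p i0) * / phi c1 (p i0) * delta i i0.
Proof.
  destruct (weight_regular p) as (_ & _ & _ & Ppos).
  destruct (partial_comp i (phi c1) (fun x => x i0) p
    (exp (p i0) * exp (p i0) * / phi c1 (p i0))) as [H1 E1].
  - apply smooth_has_partial, smooth_coord.
  - assert (X := exp_pos (2 * p i0)).
    unfold phi in *; auto_derive; [nra |].
    replace (c1 * (c1 * 1)) with (c1 ^ 2) by ring.
    rewrite <- exp_plus; replace (p i0 + p i0) with (2 * p i0) by ring.
    field; lra.
  - split; [exact H1 | rewrite E1, partial_coord; reflexivity].
Qed.

Lemma kahler_form_extends : extends_to_M c1 (omega c1) (kahler_form gM JM).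
Proof.
  intros p i j.
  rewrite (frame_pullback (kahler_form gM JM) (fun m n q => weight n q * Jframe n m)).
  2: { intros q k l; unfold gM, JM.
       rewrite (frame_kahler_form coframe frame weight coframe_frame Jframe).
       unfold sum4; ring. }
  destruct (weight_regular p) as (W0 & W2 & Hphi & Ppos).
  assert (W1 : weight i1 (regular_part c1 p) = phi c1 (p i0)) by exact W0.
  assert (W3 : weight i3 (regular_part c1 p) = / phi c1 (p i0)) by exact W2.
  assert (Z : sin (p i3) * sin (p i3) = 1 - cos (p i3) * cos (p i3)).
  { generalize (sin2_cos2 (p i3)); unfold Rsqr; lra. }
  assert (O : forall i j, partial i (fun x => scale1 (fun p => phi c1 (p i0)) sigma3 x j) p
    = exp (p i0) * exp (p i0) * / phi c1 (p i0) * delta i i0 * sigma3 p j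
      + phi c1 (p i0) * (delta i i1 * delta j i2)).
  { intros k l; unfold scale1.
    destruct (partial_phi k p) as [H1 E1].
    assert (Sg : smooth (fun x => sigma3 x l)).
    { destruct l; unfold sigma3; simpl; auto using smooth_const, smooth_coord. }
    rewrite (partial_mult k (fun x => phi c1 (x i0)) (fun x => sigma3 x l)), E1
      by auto using smooth_has_partial.
    f_equal; f_equal.
    unfold sigma3; destruct l; simpl;
      rewrite ?partial_const, ?partial_coord; unfold delta; simpl; ring. }
  unfold omega, Defs.d1; rewrite !O.
  unfold sum4; rewrite W0, W1, W2, W3.
  set (f := / phi c1 (p i0)); clearbody f.
  destruct i, j; unfold pull_coframe, sigma3, delta; simpl; ring [Z].
Qed.
End Metric.

Theorem theorem2 (c1 : R) (hc1 : 0 < c1) :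
  exists (g : tensor2) (J : endo),
    riemannian g /\
    extends_to_M c1 (metric c1) g /\
    extends_to_M c1 (omega c1) (kahler_form g J) /\
    complete g /\
    centrally_flat g J.
Proof.
  destruct (profile_exists c1 hc1) as (h & arc_h & h_arc).
  exists (gM c1 h), (JM h); repeat match goal with |- _ /\ _ => split end.
  all: eauto using gM_riemannian, gM_extends, kahler_form_extends, gM_complete, gM_centrally_flat.
Qed.
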